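(* Let $V$ be the $2n$-dimensional vector representation of $U_{r,s}(\mathfrak{so}_{2n})$, with basis $v_1,\dots,v_{2n}$, and let $R=R_{V,V}=\Theta\circ\widetilde f\circ P: V\otimes V\to V\otimes V$ be the braiding operator. Write $i'=2n+1-i$ and let $E_{kl}$ be the matrix units ($E_{kl}v_m=\delta_{lm}v_k$). Put $$S_1=\{(i,j):1\le i\le n-1,\ i+1\le j\le n\}\cup\{(i,j):1\le i\le n-1,\ i'+1\le j\le 2n\}\cup\{(n,j): n+2\le j\le 2n\},$$ $$S_2=\{(i,j): n+1\le i\le 2n-1,\ i+1\le j\le 2n\}\cup\{(i,j):1\le i\le n-1,\ n+1\le j\le 2n-i\},$$ and $\rho_i=n-i$ for $1\le i\le n$, $\rho_{n+1}=0$, $\rho_i=n-i+1$ for $n+2\le i\le 2n$. Then $$\begin{aligned}R=\;&r^{-\frac12}s^{\frac12}\sum_{i=1}^{2n}E_{ii}\otimes E_{ii}+r^{\frac12}s^{-\frac12}\sum_{i=1}^{2n}E_{ii'}\otimes E_{i'i}\\&+r^{-\frac12}s^{-\frac12}\Bigl\{\sum_{(i,j)\in S_1}E_{ij}\otimes E_{ji}+\sum_{(i,j)\in S_2}E_{ji}\otimes E_{ij}\Bigr\}\\&+r^{\frac12}s^{\frac12}\Bigl\{\sum_{(i,j)\in S_1}E_{ji}\otimes E_{ij}+\sum_{(i,j)\in S_2}E_{ij}\otimes E_{ji}\Bigr\}\\&+(r^{-\frac12}s^{\frac12}-r^{\frac12}s^{-\frac12})\Bigl\{\sum_{i<j}E_{jj}\otimes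 E_{ii}-\sum_{i>j}(r^{-\frac12}s^{\frac12})^{\rho_i-\rho_j}E_{ij'}\otimes E_{i'j}\Bigr\}.\end{aligned}$$
   Context: Let $n\ge 4$, let $r,s$ be algebraically independent over $\mathbb Q$, and let $\mathbb K\supseteq\mathbb Q(r,s)$ be a field containing fixed square roots $r^{1/2},s^{1/2}$. Let $\epsilon_1,\dots,\epsilon_n$ be an orthonormal basis of $\mathbb R^n$, with simple roots $\alpha_i=\epsilon_i-\epsilon_{i+1}$ ($i<n$), $\alpha_n=\epsilon_{n-1}+\epsilon_n$ of type $D_n$ and Cartan matrix $(a_{ij})$. Define $p_{ij}=\langle w_i',w_j\rangle$ by: $p_{ii}=rs^{-1}$; $p_{i,i+1}=r^{-1}$ and $p_{i+1,i}=s$ for $1\le i\le n-2$; $p_{n-2,n}=r^{-1}$, $p_{n,n-2}=s$; $p_{n-1,n}=r^{-1}s^{-1}$, $p_{n,n-1}=rs$; all other $p_{ij}=1$. $U=U_{r,s}(\mathfrak{so}_{2n})$ is the unital associative algebra generated by $e_i,f_i,w_i^{\pm1},w_i'^{\pm1}$ ($1\le i\le n$) with relations: the $w_i^{\pm1},w_i'^{\pm1}$ commute and $w_iw_i^{-1}=w_i'w_i'^{-1}=1$; $w_je_i=p_{ij}e_iw_j$, $w_jf_i=p_{ij}^{-1}f_iw_j$, $w_j'e_i=p_{ji}^{-1}e_iw_j'$, $w_j'f_i=p_{ji}f_iw_j'$; $[e_i,f_j]=\delta_{ij}\frac{w_i-w_i'}{r-s}$; $[e_i,e_j]=[f_i,f_j]=0$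 if $i\ne j$, $a_{ij}=0$, $\{i,j\}\neq\{n-1,n\}$; $e_{n-1}e_n=rs\,e_ne_{n-1}$, $f_nf_{n-1}=rs\,f_{n-1}f_n$; and for $i<j$ with $a_{ij}=-1$: $e_i^2e_j-(r+s)e_ie_je_i+rs\,e_je_i^2=0$, $f_jf_i^2-(r+s)f_if_jf_i+rs\,f_i^2f_j=0$, $e_j^2e_i-(r^{-1}+s^{-1})e_je_ie_j+r^{-1}s^{-1}e_ie_j^2=0$, $f_if_j^2-(r^{-1}+s^{-1})f_jf_if_j+r^{-1}s^{-1}f_j^2f_i=0$. It is a Hopf algebra with $\Delta(e_i)=e_i\otimes1+w_i\otimes e_i$, $\Delta(f_i)=1\otimes f_i+f_i\otimes w_i'$, and $w_i,w_i'$ group-like. Vector representation: $V=\bigoplus_{j=1}^{2n}\mathbb Kv_j$, where for $1\le i\le n-1$ $e_i\mapsto E_{i,i+1}-(rs)^{-1/2}E_{(i+1)',i'}$, $f_i\mapsto E_{i+1,i}-(rs)^{-1/2}E_{i',(i+1)'}$, $e_n\mapsto E_{n,n+2}-(rs)^{-1/2}E_{n-1,n+1}$, $f_n\mapsto E_{n+2,n}-(rs)^{-1/2}E_{n+1,n-1}$; $w_i$ (resp. $w_i'$) is diagonal with eigenvalues $r,s,s^{-1},r^{-1}$ (resp. $s,r,r^{-1},s^{-1}$) on $v_i,v_{i+1},v_{(i+1)'},v_{i'}$ and $1$ on the other basis vectors; $w_n$ (resp. $w'_n$) is diagonal with eigenvalues $s^{-1},r,r^{-1},s$ (resp. $r^{-1},s,s^{-1},r$)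 on $v_{n-1},v_n,v_{n'},v_{(n-1)'}$, and $r^{-1}s^{-1}$ on $v_j$, $rs$ on $v_{j'}$ for $1\le j\le n-2$. The vector $v_i$ has weight $\epsilon_i$ and $v_{i'}$ has weight $-\epsilon_i$ ($1\le i\le n$). For weights $\mu=\sum\mu_i\alpha_i$, $\lambda=\sum\lambda_j\alpha_j$ (rational coefficients) put $\langle w'_\mu,w_\lambda\rangle=\prod_{i,j}p_{ij}^{\mu_i\lambda_j}$ (for $\lambda,\mu\in\{\pm\epsilon_i\}$ this is a monomial in $r^{1/2},s^{1/2}$), and $f(\lambda,\mu)=\langle w'_\mu,w_\lambda\rangle^{-1}$. Then $\widetilde f(m\otimes m')=f(\lambda,\mu)\,m\otimes m'$ for $m$ of weight $\lambda$, $m'$ of weight $\mu$; $P(m\otimes m')=m'\otimes m$. Let $B$ be the subalgebra generated by the $e_i,w_i^{\pm1}$ and $B'$ the one generated by the $f_i,w_i'^{\pm1}$. Let $\langle\,,\rangle:B'\times B\to\mathbb K$ be the skew-dual pairing: $\langle f,ab\rangle=\langle\Delta^{op}(f),a\otimes b\rangle$, $\langle fg,a\rangle=\langle f\otimes g,\Delta(a)\rangle$, $\langle 1,a\rangle=\varepsilon(a)$, $\langle f,1\rangle=\varepsilon(f)$, $\langle f_i,e_j\rangle=\delta_{ij}/(s-r)$, $\langle w_i',w_j\rangle=p_{ij}$, $\langle f_i,w_j\rangle=\langle w_i',e_j\rangle=0$. For $\zeta\in\sum\mathbb Z_{\ge0}\alpha_i$, let $\{u_k^\zeta\}$ be a basis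 of the weight-$\zeta$ part of the subalgebra generated by the $e_i$ and $\{v_k^\zeta\}$ the dual basis (with respect to this pairing) of the weight-$(-\zeta)$ part of the subalgebra generated by the $f_i$. Then $\Theta=\sum_\zeta\sum_k v_k^\zeta\otimes u_k^\zeta$, which acts as a finite sum on $V\otimes V$. *)

(* Defs.v *)
From HB Require Import structures.
From mathcomp Require Import all_boot all_order all_algebra.
From mathcomp Require Import mxtens finmap.
From mathcomp Require Import boolp classical_sets fsbigop.
From mathcomp Require Import monalg.

Set Implicit Arguments.
Unset Strict Implicit.
Unset Printing Implicit Defensive.
Import Order.TTheory GRing.Theory Num.Theory.
Local Open Scope ring_scope.
Local Open Scope quotient_scope.

Notation free_alg K X := {malg K[{fmonom X}]}.

Definition fgen (K : fieldType) (X : choiceType) (x : X) : free_alg K X :=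
  << fmu x >>.

Lemma free_scaleAr (K : fieldType) (X : choiceType) (c : K)
  (x y : free_alg K X) : c *: (x * y) = x * (c *: y).
Proof.
rewrite (malgME x) (malgMEw (fsubset_refl _) (@msuppZ_le _ _ c y)).
rewrite scaler_sumr; apply: eq_bigr => k1 _.
rewrite scaler_sumr; apply: eq_bigr => k2 _.
by apply/malgP => k; rewrite !(mcoeffZ, mcoeffU) mulrnAr mulrCA.
Qed.

Inductive two_sided_ideal (A : pzRingType) (S : set A) : set A :=
| ideal_incl x : S x -> two_sided_ideal S x
| ideal_zero : two_sided_ideal S 0
| ideal_add x y :
    two_sided_ideal S x -> two_sided_ideal S y -> two_sided_ideal S (x + y)
| ideal_mull a x : two_sided_ideal S x -> two_sided_ideal S (a * x)
| ideal_mulr a x : two_sided_ideal S x -> two_sided_ideal S (x * a).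

(* presented rel is the unital associative K-algebra with generators X and     *)
(* relations u = v for rel u v.  MathComp's algType is restricted to nonzero   *)
(* algebras, so only the pzRingType and lmodType structures are declared here; *)
(* their compatibility is given by presented_scaleAl and presented_scaleAr.    *)
Section Presented.
Variables (K : fieldType) (X : choiceType).
Local Notation F := (free_alg K X).
Variable rel : F -> F -> Prop.

Definition relators : set F := fun x => exists u v, rel u v /\ x = u - v.

Local Notation I := (two_sided_ideal relators).

Definition presented_equiv (x y : F) : bool := `[< I (x - y) >].

Lemma ideal_opp x : I x -> I (- x).
Proof. by rewrite -mulN1r; apply: ideal_mull. Qed.

Lemma presented_equiv_refl : reflexive presented_equiv.
Proof. by move=> x; apply/asboolP; rewrite subrr; apply: ideal_zero. Qed.

Lemma presented_equiv_sym : symmetric presented_equiv.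
Proof.
move=> x y; apply/asboolP/asboolP => /ideal_opp; by rewrite opprB.
Qed.

Lemma presented_equiv_trans : transitive presented_equiv.
Proof.
move=> y x z /asboolP xy /asboolP yz; apply/asboolP.
by rewrite -(subrKA y); apply: ideal_add.
Qed.

Canonical presented_equivRel := EquivRel presented_equiv
  presented_equiv_refl presented_equiv_sym presented_equiv_trans.

Definition presented : Type := {eq_quot presented_equivRel}.
HB.instance Definition _ := Choice.on presented.
HB.instance Definition _ := Quotient.on presented.

Definition presented_pi (x : F) : presented := \pi_presented x.

Lemma presented_piP x y : reflect (I (x - y)) (presented_pi x == presented_pi y).
Proof.
rewrite /presented_pi.
have -> : (\pi_presented x == \pi_presented y) = presented_equiv x y.
  exact: (eqmodE presented_equivRel).
exact: asboolP.
Qed.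

Lemma presented_piE x y : I (x - y) -> presented_pi x = presented_pi y.
Proof. by move=> h; apply/eqP/presented_piP. Qed.

Lemma presented_reprK (x : presented) : presented_pi (repr x) = x.
Proof. exact: reprK. Qed.

Lemma presented_ind (P : presented -> Prop) :
  (forall x, P (presented_pi x)) -> forall x, P x.
Proof. by move=> h x; rewrite -(presented_reprK x). Qed.

Lemma presented_pi_repr x : I (repr (presented_pi x) - x).
Proof. by apply/presented_piP; rewrite presented_reprK. Qed.

Definition presented_zero := presented_pi 0.
Definition presented_one := presented_pi 1.
Definition presented_opp (x : presented) := presented_pi (- repr x).
Definition presented_add (x y : presented) := presented_pi (repr x + repr y).
Definition presented_mul (x y : presented) := presented_pi (repr x * repr y).
Definition presented_scale (c : K) (x : presented) := presented_pi (c *: repr x).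

Lemma presented_oppE x : presented_opp (presented_pi x) = presented_pi (- x).
Proof.
apply: presented_piE; rewrite opprK addrC -opprB.
exact/ideal_opp/presented_pi_repr.
Qed.

Lemma presented_addE x y :
  presented_add (presented_pi x) (presented_pi y) = presented_pi (x + y).
Proof.
apply: presented_piE; rewrite opprD addrACA.
by apply: ideal_add; apply: presented_pi_repr.
Qed.

Lemma presented_mulE x y :
  presented_mul (presented_pi x) (presented_pi y) = presented_pi (x * y).
Proof.
apply: presented_piE; set x' := repr _; set y' := repr _.
have -> : x' * y' - x * y = (x' - x) * y' + x * (y' - y).
  by rewrite mulrBl mulrBr addrA subrK.
by apply: ideal_add; [apply: ideal_mulr|apply: ideal_mull];
  apply: presented_pi_repr.
Qed.

Lemma presented_scaleE c x :
  presented_scale c (presented_pi x) = presented_pi (c *: x).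
Proof.
apply: presented_piE; rewrite -scalerBr -[X in c *: X]mul1r scalerAl.
exact/ideal_mull/presented_pi_repr.
Qed.

Let E := (presented_oppE, presented_addE, presented_mulE, presented_scaleE).

Lemma presented_addA : associative presented_add.
Proof.
by elim/presented_ind => x; elim/presented_ind => y; elim/presented_ind => z;
  rewrite !E addrA.
Qed.

Lemma presented_addC : commutative presented_add.
Proof.
by elim/presented_ind => x; elim/presented_ind => y; rewrite !E addrC.
Qed.

Lemma presented_add0 : left_id presented_zero presented_add.
Proof. by elim/presented_ind => x; rewrite !E add0r. Qed.

Lemma presented_addN : left_inverse presented_zero presented_opp presented_add.
Proof. by elim/presented_ind => x; rewrite !E addNr. Qed.

HB.instance Definition _ := GRing.isZmodule.Build presented
  presented_addA presented_addC presented_add0 presented_addN.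

Lemma presented_mulA : associative presented_mul.
Proof.
by elim/presented_ind => x; elim/presented_ind => y; elim/presented_ind => z;
  rewrite !E mulrA.
Qed.

Lemma presented_mul1l : left_id presented_one presented_mul.
Proof. by elim/presented_ind => x; rewrite !E mul1r. Qed.

Lemma presented_mul1r : right_id presented_one presented_mul.
Proof. by elim/presented_ind => x; rewrite !E mulr1. Qed.

Lemma presented_mulDl : left_distributive presented_mul presented_add.
Proof.
by elim/presented_ind => x; elim/presented_ind => y; elim/presented_ind => z;
  rewrite !E mulrDl.
Qed.

Lemma presented_mulDr : right_distributive presented_mul presented_add.
Proof.
by elim/presented_ind => x; elim/presented_ind => y; elim/presented_ind => z;
  rewrite !E mulrDr.
Qed.

HB.instance Definition _ := GRing.Zmodule_isPzRing.Build presented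
  presented_mulA presented_mul1l presented_mul1r
  presented_mulDl presented_mulDr.

Lemma presented_scaleA a b x :
  presented_scale a (presented_scale b x) = presented_scale (a * b) x.
Proof. by elim/presented_ind: x => x; rewrite !E scalerA. Qed.

Lemma presented_scale1 : left_id 1 presented_scale.
Proof. by elim/presented_ind => x; rewrite !E scale1r. Qed.

Lemma presented_scaleDr : right_distributive presented_scale +%R.
Proof.
move=> c; elim/presented_ind => x; elim/presented_ind => y.
by rewrite -[LHS]/(presented_scale c (presented_add _ _))
  -[RHS]/(presented_add _ _) !E scalerDr.
Qed.

Lemma presented_scaleDl x : {morph presented_scale^~ x : a b / a + b}.
Proof.
elim/presented_ind: x => x a b.
by rewrite -[RHS]/(presented_add _ _) !E scalerDl.
Qed.

HB.instance Definition _ := GRing.Zmodule_isLmodule.Build K presented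
  presented_scaleA presented_scale1 presented_scaleDr presented_scaleDl.

Lemma presented_pi_is_additive : zmod_morphism presented_pi.
Proof.
move=> x y; rewrite -[RHS]/(presented_add _ (presented_opp _)).
by rewrite !E.
Qed.
HB.instance Definition _ :=
  GRing.isZmodMorphism.Build F presented presented_pi presented_pi_is_additive.

Lemma presented_pi_is_multiplicative : monoid_morphism presented_pi.
Proof.
by split=> // x y; rewrite -[RHS]/(presented_mul _ _) !E.
Qed.
HB.instance Definition _ := GRing.isMonoidMorphism.Build F presented
  presented_pi presented_pi_is_multiplicative.

Lemma presented_piZ : scalable presented_pi.
Proof. by move=> c x; rewrite -[RHS]/(presented_scale _ _) !E. Qed.

Lemma presented_scaleAl c (x y : presented) : c *: (x * y) = (c *: x) * y.
Proof.
rewrite -(presented_reprK x) -(presented_reprK y).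
by rewrite -rmorphM -!presented_piZ -rmorphM /= scalerAl.
Qed.

Lemma presented_scaleAr c (x y : presented) : c *: (x * y) = x * (c *: y).
Proof.
rewrite -(presented_reprK x) -(presented_reprK y).
by rewrite -rmorphM -!presented_piZ -rmorphM /= free_scaleAr.
Qed.

Lemma presented_rel u v : rel u v -> presented_pi u = presented_pi v.
Proof.
by move=> h; apply/presented_piE/ideal_incl; exists u, v.
Qed.

Definition pgen (x : X) : presented := presented_pi (fgen K x).

Inductive subalgebra (G : set presented) : set presented :=
| subalg_gen x : G x -> subalgebra G x
| subalg_one : subalgebra G 1
| subalg_lin c x y :
    subalgebra G x -> subalgebra G y -> subalgebra G (c *: x + y)
| subalg_mul x y : subalgebra G x -> subalgebra G y -> subalgebra G (x * y).

End Presented.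

(* A (x) B as the algebra generated by the symbols a (x) b subject to          *)
(* bilinearity and (a (x) b) (a' (x) b') = aa' (x) bb', 1 (x) 1 = 1.           *)
Section TensorAlgebra.
Variables (K : fieldType) (X Y : choiceType).
Variables (relX : free_alg K X -> free_alg K X -> Prop).
Variables (relY : free_alg K Y -> free_alg K Y -> Prop).
Local Notation A := (presented relX).
Local Notation B := (presented relY).
Local Notation t a b := (fgen K ((a, b) : (A * B)%type)).

Inductive tensor_rel : free_alg K (A * B)%type -> free_alg K (A * B)%type -> Prop :=
| tensor_rel_linl c a a' b :
    tensor_rel (t (c *: a + a') b) (c *: t a b + t a' b)
| tensor_rel_linr c a b b' :
    tensor_rel (t a (c *: b + b')) (c *: t a b + t a b')
| tensor_rel_one : tensor_rel (t 1 1) 1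
| tensor_rel_mul a a' b b' :
    tensor_rel (t a b * t a' b') (t (a * a') (b * b')).

Definition tensor_alg := presented tensor_rel.
HB.instance Definition _ := GRing.PzRing.on tensor_alg.
HB.instance Definition _ := GRing.Lmodule.on tensor_alg.
Definition tensor (a : A) (b : B) : tensor_alg := pgen tensor_rel (a, b).

End TensorAlgebra.

Section LinearAlgebra.
Variables (K : fieldType) (V : lmodType K).

Definition lin_span (G : set V) : set V := fun x =>
  exists m (c : 'I_m -> K) (g : 'I_m -> V),
    (forall i, G (g i)) /\ x = \sum_i c i *: g i.

Definition basis_of_set (S : set V) d (u : 'I_d -> V) : Prop :=
  (forall k, S (u k)) /\
  (forall x, S x -> exists! c : {ffun 'I_d -> K}, x = \sum_k c k *: u k).

End LinearAlgebra.

Definition alg_independent2 (K : fieldType) (r s : K) : Prop :=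
  forall P : {poly {poly rat}}, P != 0 ->
    (map_poly (fun p : {poly rat} => (map_poly ratr p).[r]) P).[s] != 0.

(* From here on the vertices of the Dynkin diagram, the coordinates of R^n and *)
(* the basis of V are labelled from 1, by natural numbers; an ordinal i : 'I_n *)
(* stands for the label i.+1.                                                  *)
Section TypeD.
Variable n : nat.

Definition epsilon (k : nat) : 'rV[rat]_n := \row_j (j.+1 == k)%:R.

Definition alpha (i : nat) : 'rV[rat]_n :=
  if i == n then epsilon (n - 1) + epsilon n else epsilon i - epsilon i.+1.

Definition dot (x y : 'rV[rat]_n) : rat := \sum_j x 0 j * y 0 j.

Definition cartan (i j : nat) : rat :=
  2 * dot (alpha i) (alpha j) / dot (alpha i) (alpha i).

Definition root_coord (x : 'rV[rat]_n) : 'rV[rat]_n :=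
  x *m invmx (\matrix_(i < n) alpha i.+1).

(* p_ij = r ^ a * s ^ b with (a, b) = pexp i j *)
Definition pexp (i j : nat) : int * int :=
  if i == j then (1, -1)
  else if (j == i.+1) && (i <= n - 2)%N then (-1, 0)
  else if (i == j.+1) && (j <= n - 2)%N then (0, 1)
  else if (i == n - 2)%N && (j == n) then (-1, 0)
  else if (i == n) && (j == n - 2)%N then (0, 1)
  else if (i == n - 1)%N && (j == n) then (-1, -1)
  else if (i == n) && (j == n - 1)%N then (1, 1)
  else (0, 0).

Definition prime_idx (i : nat) : nat := (2 * n + 1 - i)%N.

Definition weight (i : nat) : 'rV[rat]_n :=
  if (i <= n)%N then epsilon i else - epsilon (prime_idx i).

Inductive gen : Type :=
| Ge of 'I_n | Gf of 'I_n
| Gw of 'I_n | GwV of 'I_n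
| Gw' of 'I_n | Gw'V of 'I_n.
HB.instance Definition _ := gen_eqMixin gen.
HB.instance Definition _ := gen_choiceMixin gen.

Definition torus_gen (g : gen) : bool :=
  match g with Ge _ | Gf _ => false | _ => true end.

End TypeD.

Section QuantumGroup.
Variables (n : nat) (K : fieldType) (r s : K).

Definition pmat (i j : nat) : K := r ^ (pexp n i j).1 * s ^ (pexp n i j).2.

Local Notation p i j := (pmat (i : 'I_n).+1 (j : 'I_n).+1).
Local Notation a i j := (cartan n (i : 'I_n).+1 (j : 'I_n).+1).
Local Notation free := (free_alg K (gen n)).
Local Notation e i := (fgen K (Ge i)).
Local Notation f i := (fgen K (Gf i)).
Local Notation w i := (fgen K (Gw i)).
Local Notation wV i := (fgen K (GwV i)).
Local Notation w' i := (fgen K (Gw' i)).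
Local Notation w'V i := (fgen K (Gw'V i)).
Local Notation lasttwo i j :=
  (((i : 'I_n).+1 == n - 1)%N && ((j : 'I_n).+1 == n)).

Inductive Urel : free -> free -> Prop :=
| Urel_torus (x y : gen n) : torus_gen x -> torus_gen y ->
    Urel (fgen K x * fgen K y) (fgen K y * fgen K x)
| Urel_w (i : 'I_n) : Urel (w i * wV i) 1
| Urel_w' (i : 'I_n) : Urel (w' i * w'V i) 1
| Urel_we (i j : 'I_n) : Urel (w j * e i) (p i j *: (e i * w j))
| Urel_wf (i j : 'I_n) : Urel (w j * f i) ((p i j)^-1 *: (f i * w j))
| Urel_w'e (i j : 'I_n) : Urel (w' j * e i) ((p j i)^-1 *: (e i * w' j))
| Urel_w'f (i j : 'I_n) : Urel (w' j * f i) (p j i *: (f i * w' j))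
| Urel_ef (i j : 'I_n) : Urel (e i * f j - f j * e i)
    (if i == j then (r - s)^-1 *: (w i - w' i) else 0)
| Urel_ee (i j : 'I_n) : i != j -> a i j = 0 ->
    ~~ lasttwo i j -> ~~ lasttwo j i ->
    Urel (e i * e j) (e j * e i)
| Urel_ff (i j : 'I_n) : i != j -> a i j = 0 ->
    ~~ lasttwo i j -> ~~ lasttwo j i ->
    Urel (f i * f j) (f j * f i)
| Urel_ee_last (i j : 'I_n) : lasttwo i j ->
    Urel (e i * e j) ((r * s) *: (e j * e i))
| Urel_ff_last (i j : 'I_n) : lasttwo i j ->
    Urel (f j * f i) ((r * s) *: (f i * f j))
| Urel_serre_e (i j : 'I_n) : (i < j)%N -> a i j = -1 ->
    Urel (e i ^+ 2 * e j - (r + s) *: (e i * e j * e i)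
          + (r * s) *: (e j * e i ^+ 2)) 0
| Urel_serre_f (i j : 'I_n) : (i < j)%N -> a i j = -1 ->
    Urel (f j * f i ^+ 2 - (r + s) *: (f i * f j * f i)
          + (r * s) *: (f i ^+ 2 * f j)) 0
| Urel_serre_e' (i j : 'I_n) : (i < j)%N -> a i j = -1 ->
    Urel (e j ^+ 2 * e i - (r^-1 + s^-1) *: (e j * e i * e j)
          + (r^-1 * s^-1) *: (e i * e j ^+ 2)) 0
| Urel_serre_f' (i j : 'I_n) : (i < j)%N -> a i j = -1 ->
    Urel (f i * f j ^+ 2 - (r^-1 + s^-1) *: (f j * f i * f j)
          + (r^-1 * s^-1) *: (f j ^+ 2 * f i)) 0.

Definition U := presented Urel.
HB.instance Definition _ := GRing.PzRing.on U.
HB.instance Definition _ := GRing.Lmodule.on U.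
Definition U2 := tensor_alg Urel Urel.
HB.instance Definition _ := GRing.PzRing.on U2.
HB.instance Definition _ := GRing.Lmodule.on U2.
Definition tens (x y : U) : U2 := tensor x y.

Definition Ue (i : 'I_n) : U := pgen Urel (Ge i).
Definition Uf (i : 'I_n) : U := pgen Urel (Gf i).
Definition Uw (i : 'I_n) : U := pgen Urel (Gw i).
Definition UwV (i : 'I_n) : U := pgen Urel (GwV i).
Definition Uw' (i : 'I_n) : U := pgen Urel (Gw' i).
Definition Uw'V (i : 'I_n) : U := pgen Urel (Gw'V i).

Definition is_coproduct (Delta : U -> U2) : Prop :=
  forall i,
    [/\ Delta (Ue i) = tens (Ue i) 1 + tens (Uw i) (Ue i),
        Delta (Uf i) = tens 1 (Uf i) + tens (Uf i) (Uw' i),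
        Delta (Uw i) = tens (Uw i) (Uw i)
      & Delta (Uw' i) = tens (Uw' i) (Uw' i)].

Definition is_counit (eps : U -> K) : Prop :=
  forall i,
    [/\ eps (Ue i) = 0, eps (Uf i) = 0, eps (Uw i) = 1 & eps (Uw' i) = 1].

Definition Bpos : set U :=
  subalgebra (fun x => exists i, x = Ue i \/ x = Uw i \/ x = UwV i).
Definition Bneg : set U :=
  subalgebra (fun x => exists i, x = Uf i \/ x = Uw' i \/ x = Uw'V i).

(* The pairing is only meaningful on Bneg x Bpos: its values elsewhere are     *)
(* unconstrained.  The first two clauses are bilinearity; in the two           *)
(* multiplicativity clauses the coproduct is expanded as a sum of pure tensors *)
(* of elements of Bneg, respectively Bpos.                                     *)
Record skew_dual_pairing (Delta : U -> U2) (eps : U -> K) (pair : U -> U -> K)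
  : Prop := {
  pair_linl : forall c x y b, Bneg x -> Bneg y -> Bpos b ->
    pair (c *: x + y) b = c * pair x b + pair y b;
  pair_linr : forall c x a b, Bneg x -> Bpos a -> Bpos b ->
    pair x (c *: a + b) = c * pair x a + pair x b;
  pair_mulr : forall x a b m (x1 x2 : 'I_m -> U),
    Bneg x -> Bpos a -> Bpos b ->
    (forall k, Bneg (x1 k)) -> (forall k, Bneg (x2 k)) ->
    Delta x = \sum_k tens (x1 k) (x2 k) ->
    pair x (a * b) = \sum_k pair (x2 k) a * pair (x1 k) b;
  pair_mull : forall x y a m (a1 a2 : 'I_m -> U),
    Bneg x -> Bneg y -> Bpos a ->
    (forall k, Bpos (a1 k)) -> (forall k, Bpos (a2 k)) ->
    Delta a = \sum_k tens (a1 k) (a2 k) ->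
    pair (x * y) a = \sum_k pair x (a1 k) * pair y (a2 k);
  pair_1l : forall a, Bpos a -> pair 1 a = eps a;
  pair_1r : forall x, Bneg x -> pair x 1 = eps x;
  pair_fe : forall i j, pair (Uf i) (Ue j) = (i == j)%:R / (s - r);
  pair_ww : forall i j, pair (Uw' i) (Uw j) = p i j;
  pair_fw : forall i j, pair (Uf i) (Uw j) = 0;
  pair_we : forall i j, pair (Uw' i) (Ue j) = 0
}.

(* The root lattice element \sum_i zeta_i alpha_i, with e_i (resp. f_i) of     *)
(* weight alpha_i (resp. - alpha_i).                                           *)
Definition Upos_weight (zeta : {ffun 'I_n -> nat}) : set U :=
  lin_span (fun x => exists t : seq 'I_n,
    (forall i, count_mem i t = zeta i) /\ x = \prod_(i <- t) Ue i).
Definition Uneg_weight (zeta : {ffun 'I_n -> nat}) : set U :=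
  lin_span (fun x => exists t : seq 'I_n,
    (forall i, count_mem i t = zeta i) /\ x = \prod_(i <- t) Uf i).

Definition dual_bases (pair : U -> U -> K) (d : {ffun 'I_n -> nat} -> nat)
  (u v : forall zeta, 'I_(d zeta) -> U) : Prop :=
  forall zeta,
    [/\ basis_of_set (Upos_weight zeta) (u zeta),
        basis_of_set (Uneg_weight zeta) (v zeta)
      & forall k l, pair (v zeta k) (u zeta l) = (k == l)%:R].

End QuantumGroup.

Section VectorRepresentation.
Variables (n : nat) (K : fieldType) (r s rh sh : K).
Local Notation bar i := (prime_idx n i).

Definition Emx (k l : nat) : 'M[K]_(2 * n) :=
  \matrix_(a, b) ((a.+1 == k) && (b.+1 == l))%:R.

Definition diag_op (c : nat -> K) : 'M[K]_(2 * n) :=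
  \sum_(1 <= k < (2 * n).+1) c k *: Emx k k.

Definition e_mx (i : nat) : 'M[K]_(2 * n) :=
  if (i < n)%N then Emx i i.+1 - (rh * sh)^-1 *: Emx (bar i.+1) (bar i)
  else Emx n (n + 2) - (rh * sh)^-1 *: Emx (n - 1) (n + 1).

Definition f_mx (i : nat) : 'M[K]_(2 * n) :=
  if (i < n)%N then Emx i.+1 i - (rh * sh)^-1 *: Emx (bar i) (bar i.+1)
  else Emx (n + 2) n - (rh * sh)^-1 *: Emx (n + 1) (n - 1).

Definition w_mx (i : nat) : 'M[K]_(2 * n) := diag_op (fun k =>
  if (i < n)%N then
    if k == i then r else if k == i.+1 then s
    else if k == (bar i.+1) then s^-1 else if k == (bar i) then r^-1 else 1
  else
    if k == (n - 1)%N then s^-1 else if k == n then r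
    else if k == (bar n) then r^-1 else if k == (bar (n - 1)) then s
    else if (k <= n - 2)%N then r^-1 * s^-1 else r * s).

Definition w'_mx (i : nat) : 'M[K]_(2 * n) := diag_op (fun k =>
  if (i < n)%N then
    if k == i then s else if k == i.+1 then r
    else if k == (bar i.+1) then r^-1 else if k == (bar i) then s^-1 else 1
  else
    if k == (n - 1)%N then r^-1 else if k == n then s
    else if k == (bar n) then s^-1 else if k == (bar (n - 1)) then r
    else if (k <= n - 2)%N then r^-1 * s^-1 else r * s).

Definition is_vector_rep (rho : U n r s -> 'M[K]_(2 * n)) : Prop :=
  forall i : 'I_n,
    [/\ rho (Ue r s i) = e_mx i.+1, rho (Uf r s i) = f_mx i.+1,
        rho (Uw r s i) = w_mx i.+1 & rho (Uw' r s i) = w'_mx i.+1].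

(* r ^ x * s ^ y for half-integers x and y, where r = rh ^ 2 and s = sh ^ 2 *)
Definition rs_monomial (x y : rat) : K := rh ^ numq (2 * x) * sh ^ numq (2 * y).

(* <w'_mu, w_lambda>: the exponents of r and s in \prod_(i, j) p_ij ^ (mu_i    *)
(* lambda_j) are added up in rat, as the individual factors may involve fourth *)
(* roots (mu_i lambda_j is in 1/4 Z) whereas the product does not.             *)
Definition weight_pairing (mu lambda : 'rV[rat]_n) : K :=
  let expo (c : int * int -> int) : rat :=
    \sum_(i < n) \sum_(j < n) root_coord mu 0 i * root_coord lambda 0 j
                                * (c (pexp n i.+1 j.+1))%:~R in
  rs_monomial (expo fst) (expo snd).

Definition f_factor (lambda mu : 'rV[rat]_n) : K :=
  (weight_pairing mu lambda)^-1.

(* Operators on V (x) V are matrices of size (2n) * (2n), and A *t B is the    *)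
(* operator A (x) B.                                                           *)
Local Notation End_VV := 'M[K]_(2 * n * (2 * n)).

Definition f_tilde : End_VV :=
  \sum_(1 <= i < (2 * n).+1) \sum_(1 <= j < (2 * n).+1)
    f_factor (weight n i) (weight n j) *: (Emx i i *t Emx j j).

Definition flip : End_VV :=
  \sum_(1 <= i < (2 * n).+1) \sum_(1 <= j < (2 * n).+1) (Emx j i *t Emx i j).

(* A finitely supported sum over all zeta: it is 0 by convention should        *)
(* infinitely many terms be nonzero.                                           *)
Definition Theta (rho : U n r s -> 'M[K]_(2 * n))
    (d : {ffun 'I_n -> nat} -> nat) (u v : forall zeta, 'I_(d zeta) -> U n r s)
  : End_VV :=
  \sum_(zeta \in [set: {ffun 'I_n -> nat}])
    \sum_k (rho (v zeta k) *t rho (u zeta k)).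

Definition R_VV (rho : U n r s -> 'M[K]_(2 * n))
    (d : {ffun 'I_n -> nat} -> nat) (u v : forall zeta, 'I_(d zeta) -> U n r s)
  : End_VV :=
  Theta rho u v *m f_tilde *m flip.

End VectorRepresentation.

Definition S1 (n i j : nat) : bool :=
  [|| [&& 1 <= i, i <= n - 1, i + 1 <= j & j <= n],
      [&& 1 <= i, i <= n - 1, prime_idx n i + 1 <= j & j <= 2 * n]
    | [&& i == n, n + 2 <= j & j <= 2 * n]]%N.

Definition S2 (n i j : nat) : bool :=
  [|| [&& n + 1 <= i, i <= 2 * n - 1, i + 1 <= j & j <= 2 * n]
    | [&& 1 <= i, i <= n - 1, n + 1 <= j & j <= 2 * n - i]]%N.

Definition rho_idx (n i : nat) : int :=
  if (i <= n)%N then n%:Z - i%:Z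
  else if i == n.+1 then 0 else n%:Z - i%:Z + 1.

(* Main.v *)
(* A lowering operator of U acts on a tensor product through G_i' = 1 (x) f_i +
   f_i (x) w'_i (the coproduct) or through G_i = 1 (x) f_i + f_i (x) w_i.

   The commutator of f_i with an element x of weight zeta in the e's is
   w'_i b - a w_i, where the skew derivatives a, b are adjoint, for the pairing,
   to right and left multiplication by f_i.  For the canonical elements this
   reads [Theta_zeta, 1 (x) f_i] = (f_i (x) w'_i) Theta_(zeta - alpha_i)
   - Theta_(zeta - alpha_i) (f_i (x) w_i), hence Theta G_i = G_i' Theta on
   V (x) V, and Theta is the identity on V (x) v_1.  Since f~ P G_i' = G_i f~ P,
   the braiding R = Theta f~ P commutes with all G_i', and R (v_1 (x) v) =
   f~ (v (x) v_1).

   These two properties determine R, because v_1 (x) V generates V (x) V under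
   the G_i'.  The right-hand side of the theorem has both of them: it is
   f~ P + kappa (L - Q) with kappa = q - q^-1, where L projects onto the
   v_a (x) v_b with b < a and Q maps v_a (x) v_b, for a = b', to a multiple of
   the sum of q^(rho_k) v_k (x) v_k' over k > b, and is 0 otherwise. *)

Require Import Defs.
From HB Require Import structures.
From mathcomp Require Import all_boot all_order all_algebra.
From mathcomp Require Import mxtens finmap.
From mathcomp Require Import boolp classical_sets fsbigop.
From mathcomp Require Import monalg.
From mathcomp Require Import zify ring.

Import Order.TTheory GRing.Theory Num.Theory.
Local Open Scope ring_scope.

(** The pairing is controlled only on [Bneg] times [Bpos], and its multiplicativity only for
    coproducts written as sums of pure tensors from these subalgebras. So everything is computed on
    words, whose coproducts are explicit lists. Words may satisfy linear relations, hence each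
    element of a weight space is merely shown to possess skew derivatives a, b; no derivation is
    defined on the algebra. One pair (a, b) serves both the commutator with f_i and the adjoints
    because <f_i, e_i> = 1/(s - r) is minus the factor 1/(r - s) in [e_i, f_i].

    On V (x) V, f~ P alone fails to commute with G_i' by (f_i (x) (w_i - w'_i)) f~ P, and kappa (L -
    Q) repairs this defect. The coefficients q^(rho_k) make the full sum of q^(rho_k) v_k (x) v_k'
    vanish under every G_i'; on a truncated sum only boundary terms survive. The commutation thus
    reduces to finitely many rational identities, one for each position of a and b relative to the
    four indices that f_i connects. *)

Section LinSpan.
Set Implicit Arguments.
Unset Strict Implicit.
Variables (K : fieldType) (V : lmodType K).
Implicit Types (G : set V) (x y : V).

Lemma lin_span_incl G x : G x -> lin_span G x.
Proof.
move=> Gx; exists 1%N, (fun=> 1), (fun=> x); split=> //.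
by rewrite big_ord1 scale1r.
Qed.

Lemma lin_span0 G : lin_span G 0.
Proof.
exists 0%N, (fun=> 0), (fun=> 0); split; last by rewrite big_ord0.
by case.
Qed.

Lemma lin_span_lin G c x y :
  lin_span G x -> lin_span G y -> lin_span G (c *: x + y).
Proof.
move=> [m1 [c1 [g1 [G1 ->]]]] [m2 [c2 [g2 [G2 ->]]]].
exists (m1 + m2)%N,
  (fun k => match split k with inl i => c * c1 i | inr j => c2 j end),
  (fun k => match split k with inl i => g1 i | inr j => g2 j end).
split; first by move=> k; case: (split k).
rewrite big_split_ord /= scaler_sumr; congr (_ + _); apply: eq_bigr => i _.
  by rewrite -[lshift _ _]/(unsplit (inl _)) unsplitK scalerA.
by rewrite -[rshift _ _]/(unsplit (inr _)) unsplitK.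
Qed.

Lemma lin_span_ind G (P : V -> Prop) :
  P 0 -> (forall c x y, G x -> P y -> P (c *: x + y)) ->
  forall x, lin_span G x -> P x.
Proof.
move=> P0 PD x [m [c [g [Gg ->]]]].
by elim/big_rec: _ => // i y _; apply: PD.
Qed.

Lemma lin_spanZ G c x : lin_span G x -> lin_span G (c *: x).
Proof. by move=> Gx; rewrite -[_ *: _]addr0; apply: lin_span_lin (lin_span0 G). Qed.

Lemma lin_spanD G x y : lin_span G x -> lin_span G y -> lin_span G (x + y).
Proof. by move=> Gx Gy; rewrite -[x]scale1r; apply: lin_span_lin. Qed.

Lemma lin_span_sub G (P : V -> Prop) :
  P 0 -> (forall c x y, P x -> P y -> P (c *: x + y)) ->
  (forall x, G x -> P x) -> forall x, lin_span G x -> P x.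
Proof.
move=> P0 PD PG; apply: lin_span_ind => // c x y /PG; exact: PD.
Qed.

End LinSpan.

(** * Skew derivations and the canonical element of a skew-dual pairing *)

Section Pairing.
Set Implicit Arguments.
Unset Strict Implicit.
Variables (K : fieldType) (n : nat) (A : lmodType K) (T : pzRingType).
Variables (one : A) (mul : A -> A -> A).
Local Notation "x ** y" := (mul x y) (at level 40, left associativity).
Hypothesis mulA : forall x y z, x ** (y ** z) = x ** y ** z.
Hypothesis mul1v : forall x, one ** x = x.
Hypothesis mulv1 : forall x, x ** one = x.
Hypothesis mulDl : forall x y z, (x + y) ** z = x ** z + y ** z.
Hypothesis mulDr : forall x y z, x ** (y + z) = x ** y + x ** z.
Hypothesis mulZl : forall c x y, (c *: x) ** y = c *: (x ** y).
Hypothesis mulZr : forall c x y, x ** (c *: y) = c *: (x ** y).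

Variables (tens : A -> A -> T) (Delta : A -> T) (eps : A -> K).
Variables (e f w w' : 'I_n -> A) (Bpos Bneg : A -> Prop).
Variables (pair : A -> A -> K) (p : 'I_n -> 'I_n -> K) (a0 : K).
Implicit Types (x y a b : A) (i j : 'I_n) (t : seq 'I_n) (c : K).

Hypothesis tensM : forall x y x' y',
  tens x y * tens x' y' = tens (x ** x') (y ** y').
Hypothesis tens1 : tens one one = 1.
Hypothesis DeltaM : forall x y, Delta (x ** y) = Delta x * Delta y.
Hypothesis Delta1 : Delta one = 1.
Hypothesis De : forall i, Delta (e i) = tens (e i) one + tens (w i) (e i).
Hypothesis Df : forall i, Delta (f i) = tens one (f i) + tens (f i) (w' i).
Hypothesis Dw : forall i, Delta (w i) = tens (w i) (w i).
Hypothesis Dw' : forall i, Delta (w' i) = tens (w' i) (w' i).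
Hypothesis eps_e : forall i, eps (e i) = 0.
Hypothesis eps_w : forall i, eps (w i) = 1.
Hypothesis eps1 : eps one = 1.

Hypothesis p_neq0 : forall i j, p i j != 0.
Hypothesis w_e : forall i j, w j ** e i = p i j *: (e i ** w j).
Hypothesis w'_e : forall i j, w' j ** e i = (p j i)^-1 *: (e i ** w' j).
Hypothesis e_f : forall i j,
  e i ** f j - f j ** e i = (i == j)%:R *: (- a0 *: (w i - w' i)).

Hypotheses (Bpos1 : Bpos one) (Bneg1 : Bneg one).
Hypotheses (Bpos_e : forall i, Bpos (e i)) (Bpos_w : forall i, Bpos (w i)).
Hypotheses (Bneg_f : forall i, Bneg (f i)) (Bneg_w' : forall i, Bneg (w' i)).
Hypothesis BposM : forall x y, Bpos x -> Bpos y -> Bpos (x ** y).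
Hypothesis BnegM : forall x y, Bneg x -> Bneg y -> Bneg (x ** y).
Hypothesis BposL : forall c x y, Bpos x -> Bpos y -> Bpos (c *: x + y).
Hypothesis BnegL : forall c x y, Bneg x -> Bneg y -> Bneg (c *: x + y).

Hypothesis pair_linl : forall c x y b, Bneg x -> Bneg y -> Bpos b ->
  pair (c *: x + y) b = c * pair x b + pair y b.
Hypothesis pair_linr : forall c x a b, Bneg x -> Bpos a -> Bpos b ->
  pair x (c *: a + b) = c * pair x a + pair x b.
Hypothesis pair_mulr : forall x a b m (x1 x2 : 'I_m -> A),
  Bneg x -> Bpos a -> Bpos b ->
  (forall k, Bneg (x1 k)) -> (forall k, Bneg (x2 k)) ->
  Delta x = \sum_k tens (x1 k) (x2 k) ->
  pair x (a ** b) = \sum_k pair (x2 k) a * pair (x1 k) b.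
Hypothesis pair_mull : forall x y a m (a1 a2 : 'I_m -> A),
  Bneg x -> Bneg y -> Bpos a ->
  (forall k, Bpos (a1 k)) -> (forall k, Bpos (a2 k)) ->
  Delta a = \sum_k tens (a1 k) (a2 k) ->
  pair (x ** y) a = \sum_k pair x (a1 k) * pair y (a2 k).
Hypothesis pair_1l : forall a, Bpos a -> pair one a = eps a.
Hypothesis pair_fe : forall i j, pair (f i) (e j) = (i == j)%:R * a0.
Hypothesis pair_ww : forall i j, pair (w' i) (w j) = p i j.
Hypothesis pair_fw : forall i j, pair (f i) (w j) = 0.
Hypothesis pair_we : forall i j, pair (w' i) (e j) = 0.
Hypothesis pair_f1 : forall i, pair (f i) one = 0.
Hypothesis pair_w'1 : forall i, pair (w' i) one = 1.

Lemma mul0v x : 0 ** x = 0.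
Proof. by rewrite -(scale0r (0 : A)) mulZl !scale0r. Qed.
Lemma mulv0 x : x ** 0 = 0.
Proof. by rewrite -(scale0r (0 : A)) mulZr !scale0r. Qed.
Lemma mulBl x y z : (x - y) ** z = x ** z - y ** z.
Proof. by rewrite -scaleN1r mulDl mulZl scaleN1r. Qed.
Lemma mulBr x y z : x ** (y - z) = x ** y - x ** z.
Proof. by rewrite -scaleN1r mulDr mulZr scaleN1r. Qed.
Lemma mul_suml (I : Type) (l : seq I) (g : I -> A) x :
  (\sum_(k <- l) g k) ** x = \sum_(k <- l) g k ** x.
Proof. exact: (big_morph (mul^~ x) (fun y z => mulDl y z x) (mul0v x)). Qed.
Lemma Bpos0 : Bpos 0.
Proof. by rewrite -(addNr one) -scaleN1r; apply: BposL Bpos1 Bpos1. Qed.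
Lemma Bneg0 : Bneg 0.
Proof. by rewrite -(addNr one) -scaleN1r; apply: BnegL Bneg1 Bneg1. Qed.

Hint Resolve Bpos0 Bneg0 : core.

Lemma pair0r x : Bneg x -> pair x 0 = 0.
Proof.
move=> Bx; have := pair_linr 1 Bx Bpos0 Bpos0.
by rewrite scale1r addr0 mul1r => /esym /eqP; rewrite -subr_eq0 addrK => /eqP.
Qed.

Lemma pair0l x : Bpos x -> pair 0 x = 0.
Proof.
move=> Bx; have := pair_linl 1 Bneg0 Bneg0 Bx.
by rewrite scale1r addr0 mul1r => /esym /eqP; rewrite -subr_eq0 addrK => /eqP.
Qed.

Lemma pair_sumr (I : eqType) (l : seq I) (c : I -> K) (g : I -> A) x :
  Bneg x -> (forall k, k \in l -> Bpos (g k)) ->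
  pair x (\sum_(k <- l) c k *: g k) = \sum_(k <- l) c k * pair x (g k) /\
  Bpos (\sum_(k <- l) c k *: g k).
Proof.
move=> Bx; elim: l => [|k l IHl] Bg; first by rewrite !big_nil pair0r.
have [|IH1 IH2] := IHl; first by move=> k' k'l; apply: Bg; rewrite inE k'l orbT.
have Bgk : Bpos (g k) by apply: Bg; rewrite inE eqxx.
by rewrite !big_cons; split; [rewrite pair_linr ?IH1|apply: BposL].
Qed.

Lemma pair_suml (I : eqType) (l : seq I) (c : I -> K) (g : I -> A) x :
  Bpos x -> (forall k, k \in l -> Bneg (g k)) ->
  pair (\sum_(k <- l) c k *: g k) x = \sum_(k <- l) c k * pair (g k) x /\
  Bneg (\sum_(k <- l) c k *: g k).
Proof.
move=> Bx; elim: l => [|k l IHl] Bg; first by rewrite !big_nil pair0l.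
have [|IH1 IH2] := IHl; first by move=> k' k'l; apply: Bg; rewrite inE k'l orbT.
have Bgk : Bneg (g k) by apply: Bg; rewrite inE eqxx.
by rewrite !big_cons; split; [rewrite pair_linl ?IH1|apply: BnegL].
Qed.

Lemma pair_mulr_seq x a b (l : seq (A * A)) :
  Bneg x -> Bpos a -> Bpos b ->
  (forall q, q \in l -> Bneg q.1 /\ Bneg q.2) ->
  Delta x = \sum_(q <- l) tens q.1 q.2 ->
  pair x (a ** b) = \sum_(q <- l) pair q.2 a * pair q.1 b.
Proof.
move=> Bx Ba Bb Bl Dx.
rewrite (pair_mulr (m := size l) (x1 := fun k => (tnth (in_tuple l) k).1)
  (x2 := fun k => (tnth (in_tuple l) k).2)) //.
- by rewrite [RHS]big_tnth.
- by move=> k; have [] := Bl _ (mem_tnth k (in_tuple l)).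
- by move=> k; have [] := Bl _ (mem_tnth k (in_tuple l)).
- by rewrite Dx big_tnth.
Qed.

Lemma pair_mull_seq x y a (l : seq (A * A)) :
  Bneg x -> Bneg y -> Bpos a ->
  (forall q, q \in l -> Bpos q.1 /\ Bpos q.2) ->
  Delta a = \sum_(q <- l) tens q.1 q.2 ->
  pair (x ** y) a = \sum_(q <- l) pair x q.1 * pair y q.2.
Proof.
move=> Bx By Ba Bl Da.
rewrite (pair_mull (m := size l) (a1 := fun k => (tnth (in_tuple l) k).1)
  (a2 := fun k => (tnth (in_tuple l) k).2)) //.
- by rewrite [RHS]big_tnth.
- by move=> k; have [] := Bl _ (mem_tnth k (in_tuple l)).
- by move=> k; have [] := Bl _ (mem_tnth k (in_tuple l)).
- by rewrite Da big_tnth.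
Qed.

(** The pairing is skew: the second leg of the coproduct meets the first factor, so the term one (x)
    f_i contributes <f_i, a> eps(b). *)
Lemma pair_f_mul i a b : Bpos a -> Bpos b ->
  pair (f i) (a ** b) = pair (f i) a * eps b + pair (w' i) a * pair (f i) b.
Proof.
move=> Ba Bb.
rewrite (pair_mulr_seq (l := [:: (one, f i); (f i, w' i)])) //.
- by rewrite !big_cons big_nil addr0 /= pair_1l.
- by move=> q; rewrite !inE => /orP[] /eqP -> /=; split.
- by rewrite Df !big_cons big_nil addr0.
Qed.

Lemma pair_w'_mul i a b : Bpos a -> Bpos b ->
  pair (w' i) (a ** b) = pair (w' i) a * pair (w' i) b.
Proof.
move=> Ba Bb.
rewrite (pair_mulr_seq (l := [:: (w' i, w' i)])) //.
- by rewrite big_seq1.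
- by move=> q; rewrite !inE => /eqP -> /=; split.
- by rewrite Dw' big_seq1.
Qed.

Lemma pair_mul_w i x y : Bneg x -> Bneg y ->
  pair (x ** y) (w i) = pair x (w i) * pair y (w i).
Proof.
move=> Bx By.
rewrite (pair_mull_seq (l := [:: (w i, w i)])) //.
- by rewrite big_seq1.
- by move=> q; rewrite !inE => /eqP -> /=; split.
- by rewrite Dw big_seq1.
Qed.

(* Monomials are indexed by reversed words, so that a letter is added on the   *)
(* right of the monomial by consing it to the word.                            *)
Fixpoint e_mon t : A := if t is j :: t' then e_mon t' ** e j else one.
Fixpoint f_mon t : A := if t is j :: t' then f_mon t' ** f j else one.

Fixpoint e_cop t : seq (A * A) :=
  if t is j :: t' then
    [seq (q.1 ** e j, q.2) | q <- e_cop t'] ++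
    [seq (q.1 ** w j, q.2 ** e j) | q <- e_cop t']
  else [:: (one, one)].
Fixpoint f_cop t : seq (A * A) :=
  if t is j :: t' then
    [seq (q.1, q.2 ** f j) | q <- f_cop t'] ++
    [seq (q.1 ** f j, q.2 ** w' j) | q <- f_cop t']
  else [:: (one, one)].

Lemma e_copP t : Delta (e_mon t) = \sum_(q <- e_cop t) tens q.1 q.2.
Proof.
elim: t => [|j t IHt] /=; first by rewrite Delta1 big_seq1 tens1.
rewrite DeltaM IHt De big_cat /= !big_map mulrDr !mulr_suml.
by congr (_ + _); apply: eq_bigr => q _; rewrite tensM ?mulv1.
Qed.

Lemma f_copP t : Delta (f_mon t) = \sum_(q <- f_cop t) tens q.1 q.2.
Proof.
elim: t => [|j t IHt] /=; first by rewrite Delta1 big_seq1 tens1.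
rewrite DeltaM IHt Df big_cat /= !big_map mulrDr !mulr_suml.
by congr (_ + _); apply: eq_bigr => q _; rewrite tensM ?mulv1.
Qed.

Lemma e_cop_Bpos t q : q \in e_cop t -> Bpos q.1 /\ Bpos q.2.
Proof.
elim: t q => [|j t IHt] q /=; first by rewrite inE => /eqP -> /=; split.
rewrite mem_cat => /orP[] /mapP[q' /IHt[B1 B2] ->] /=;
  split=> //; exact: BposM.
Qed.

Lemma f_cop_Bneg t q : q \in f_cop t -> Bneg q.1 /\ Bneg q.2.
Proof.
elim: t q => [|j t IHt] q /=; first by rewrite inE => /eqP -> /=; split.
rewrite mem_cat => /orP[] /mapP[q' /IHt[B1 B2] ->] /=;
  split=> //; exact: BnegM.
Qed.

Lemma e_mon_Bpos t : Bpos (e_mon t).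
Proof. by elim: t => //= j t IHt; apply: BposM. Qed.
Lemma f_mon_Bneg t : Bneg (f_mon t).
Proof. by elim: t => //= j t IHt; apply: BnegM. Qed.
Hint Resolve e_mon_Bpos f_mon_Bneg : core.

(** Pairing with the group-like w_i is multiplicative and kills every f_j, so only the tensor one
    (x) [f_mon t] of the coproduct survives. *)
Lemma f_mon_pair_w t i :
  \sum_(q <- f_cop t) pair q.1 (w i) *: q.2 = f_mon t.
Proof.
elim: t => [|j t IHt] /=; first by rewrite big_seq1 pair_1l // eps_w scale1r.
rewrite big_cat /= !big_map /= -[RHS]addr0; congr (_ + _).
  by rewrite -IHt mul_suml; apply: eq_bigr => q _; rewrite mulZl.
rewrite big1_seq // => q /andP[_ /f_cop_Bneg[B1 B2]].
by rewrite pair_mul_w // pair_fw mulr0 scale0r.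
Qed.

(* A torus element on the right is invisible to the monomials in the f's. *)
Lemma pair_f_mon_mul_w t a i :
  Bpos a -> pair (f_mon t) (a ** w i) = pair (f_mon t) a.
Proof.
move=> Ba; rewrite (pair_mulr_seq (l := f_cop t)) //; last exact: f_copP.
  rewrite -[in RHS](f_mon_pair_w t i).
  have [|-> _] := pair_suml (l := f_cop t) (fun q => pair q.1 (w i)) (g := @snd A A) Ba.
    by move=> q /f_cop_Bneg[].
  by apply: eq_bigr => q _; rewrite mulrC.
exact: f_cop_Bneg.
Qed.

(** The right skew derivative: pairing the second leg of the coproduct with f_i leaves [e_derR i t]
    times w_i. The scalar [p j i] comes from moving w_i to the right past e_j. *)
Fixpoint e_derR i t : A :=
  if t is j :: t' then
    p j i *: (e_derR i t' ** e j) + ((i == j)%:R * a0) *: e_mon t'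
  else 0.

(** The conjugate w'_i^-1 x w'_i of a monomial x, written without inverses. *)
Fixpoint e_twist i t : A :=
  if t is j :: t' then p i j *: (e_twist i t' ** e j) else one.

(** The left skew derivative, obtained by pairing the first leg of the coproduct with f_i. The
    letters e_k to the left of the selected e_i leave w_k in that leg; the twist collects the
    resulting scalars <w'_i, w_k>. *)
Fixpoint e_derL i t : A :=
  if t is j :: t' then
    e_derL i t' ** e j + ((i == j)%:R * a0) *: e_twist i t'
  else 0.

Lemma e_cop_w'_r i t : \sum_(q <- e_cop t) pair (w' i) q.2 *: q.1 = e_mon t.
Proof.
elim: t => [|j t IHt] /=; first by rewrite big_seq1 pair_w'1 scale1r.
rewrite big_cat /= !big_map /= -[RHS]addr0; congr (_ + _).
  by rewrite -IHt mul_suml; apply: eq_bigr => q _; rewrite mulZl.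
rewrite big1_seq // => q /andP[_ /e_cop_Bpos[B1 B2]].
by rewrite pair_w'_mul // pair_we mulr0 scale0r.
Qed.

Lemma e_cop_f_r i t :
  \sum_(q <- e_cop t) pair (f i) q.2 *: q.1 = e_derR i t ** w i.
Proof.
elim: t => [|j t IHt] /=; first by rewrite big_seq1 pair_f1 scale0r mul0v.
rewrite big_cat /= !big_map /= mulDl; congr (_ + _).
  rewrite mulZl -mulA -mulZr -w_e mulA -IHt mul_suml.
  by apply: eq_bigr => q _; rewrite mulZl.
rewrite -[in RHS](e_cop_w'_r i) mulZl mul_suml scaler_sumr.
rewrite big_seq [RHS]big_seq; apply: eq_bigr => q /e_cop_Bpos[B1 B2].
rewrite pair_f_mul // eps_e mulr0 add0r pair_fe mulZl scalerA mulrC.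
by case: eqP => [->|_]; rewrite ?mul0r ?scale0r.
Qed.

Lemma e_cop_w'_l i t :
  \sum_(q <- e_cop t) pair (w' i) q.1 *: q.2 = e_twist i t.
Proof.
elim: t => [|j t IHt] /=; first by rewrite big_seq1 pair_w'1 scale1r.
rewrite big_cat /= !big_map /= -[RHS]add0r; congr (_ + _).
  rewrite big1_seq // => q /andP[_ /e_cop_Bpos[B1 B2]].
  by rewrite pair_w'_mul // pair_we mulr0 scale0r.
rewrite -IHt mul_suml scaler_sumr.
rewrite big_seq [RHS]big_seq; apply: eq_bigr => q /e_cop_Bpos[B1 B2].
by rewrite pair_w'_mul // pair_ww mulZl scalerA mulrC.
Qed.

Lemma e_cop_f_l i t :
  \sum_(q <- e_cop t) pair (f i) q.1 *: q.2 = e_derL i t.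
Proof.
elim: t => [|j t IHt] /=; first by rewrite big_seq1 pair_f1 scale0r.
rewrite big_cat /= !big_map /= addrC; congr (_ + _).
  rewrite -IHt mul_suml big_seq [RHS]big_seq.
  apply: eq_bigr => q /e_cop_Bpos[B1 B2].
  by rewrite pair_f_mul // eps_w mulr1 pair_fw mulr0 addr0 mulZl.
rewrite -(e_cop_w'_l i) scaler_sumr.
rewrite big_seq [RHS]big_seq; apply: eq_bigr => q /e_cop_Bpos[B1 B2].
by rewrite pair_f_mul // eps_e mulr0 add0r pair_fe scalerA mulrC.
Qed.

Lemma w'_e_twist i t : w' i ** e_twist i t = e_mon t ** w' i.
Proof.
elim: t => [|j t IHt] /=; first by rewrite mulv1 mul1v.
rewrite mulZr mulA IHt -!mulA w'_e mulZr scalerA.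
by rewrite divff // scale1r.
Qed.

(** A new letter e_i contributes [e_i, f_i] = -a0 (w_i - w'_i). Moving w'_i to the left past the
    monomial produces [e_twist], while w_i already stands on the right. Since a0 is also the value
    of the pairing on f_i and e_i, the derivatives agree with those read off from the coproduct. *)
Lemma e_mon_commutator i t :
  e_mon t ** f i - f i ** e_mon t = w' i ** e_derL i t - e_derR i t ** w i.
Proof.
elim: t => [|j t IHt] /=; first by rewrite mulv1 mul1v mulv0 mul0v !subrr.
have -> : e_mon t ** e j ** f i - f i ** (e_mon t ** e j) =
    e_mon t ** (e j ** f i - f i ** e j) + (e_mon t ** f i - f i ** e_mon t) ** e j.
  by rewrite mulBr mulBl !mulA subrKA.
rewrite e_f IHt mulBl mulDl mulDr !mulZl !mulZr w'_e_twist.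
rewrite -[e_derR i t ** e j ** w i]mulA -[p j i *: _]mulZr -w_e !mulA.
rewrite [j == i]eq_sym; case: eqP => [->|_]; last first.
  by rewrite !mul0r !scale0r !addr0 add0r.
rewrite !mul1r scale1r mulBr scaleNr scalerBr opprB.
by rewrite opprD [RHS]addrACA addrC.
Qed.

Lemma pair_mulf_e_mon y i t : Bneg y ->
  pair (y ** f i) (e_mon t) = pair y (e_derR i t ** w i).
Proof.
move=> By; rewrite (pair_mull_seq (l := e_cop t)) //; last exact: e_copP.
  rewrite -e_cop_f_r.
  have [|-> _] := pair_sumr (l := e_cop t) (fun q => pair (f i) q.2)
    (g := @fst A A) By.
    by move=> q /e_cop_Bpos[].
  by apply: eq_bigr => q _; rewrite mulrC.
exact: e_cop_Bpos.
Qed.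

Lemma pair_fmul_e_mon y i t : Bneg y ->
  pair (f i ** y) (e_mon t) = pair y (e_derL i t).
Proof.
move=> By; rewrite (pair_mull_seq (l := e_cop t)) //; last exact: e_copP.
  rewrite -e_cop_f_l.
  by have [|-> _] := pair_sumr (l := e_cop t) (fun q => pair (f i) q.1)
    (g := @snd A A) By; first by move=> q /e_cop_Bpos[].
exact: e_cop_Bpos.
Qed.

Lemma lin_span_e_mulr (G G' : set A) j :
  (forall x, G x -> lin_span G' (x ** e j)) ->
  forall x, lin_span G x -> lin_span G' (x ** e j).
Proof.
move=> GG'; apply: (@lin_span_sub _ _ _ (fun x => lin_span G' (x ** e j))) => //.
  by rewrite mul0v; exact: lin_span0.
by move=> c x y Gx Gy; rewrite mulDl mulZl; exact: lin_span_lin.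
Qed.

Definition e_without i t : set A :=
  fun x => exists t', perm_eq t (i :: t') /\ x = e_mon t'.

Lemma e_without_mulr i j t x :
  e_without i t x -> lin_span (e_without i (j :: t)) (x ** e j).
Proof.
move=> [t' [tt' ->]]; apply: lin_span_incl; exists (j :: t'); split=> //.
apply: (perm_trans (y := j :: i :: t')); first by rewrite perm_cons.
exact/permPl/(perm_catCA [:: j] [:: i] t').
Qed.

Lemma e_twist_mon i t : exists c, e_twist i t = c *: e_mon t.
Proof.
elim: t => [|j t [c IHt]] /=; first by exists 1; rewrite scale1r.
by exists (p i j * c); rewrite IHt mulZl scalerA.
Qed.

Lemma e_without_delta i j t c : lin_span (e_without i (j :: t))
  (((i == j)%:R * a0 * c) *: e_mon t).
Proof.
case: eqP => [->|_]; last by rewrite !mul0r scale0r; exact: lin_span0.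
by apply/lin_spanZ/lin_span_incl; exists t.
Qed.

Lemma e_derR_span i t : lin_span (e_without i t) (e_derR i t).
Proof.
elim: t => [|j t IHt] /=; first exact: lin_span0.
apply: lin_span_lin; last by rewrite -[_ * a0]mulr1; exact: e_without_delta.
exact: lin_span_e_mulr (@e_without_mulr i j t) _ IHt.
Qed.

Lemma e_derL_span i t : lin_span (e_without i t) (e_derL i t).
Proof.
elim: t => [|j t IHt] /=; first exact: lin_span0.
apply: lin_spanD; first exact: lin_span_e_mulr (@e_without_mulr i j t) _ IHt.
by have [c ->] := e_twist_mon i t; rewrite scalerA; exact: e_without_delta.
Qed.

Definition e_mons (zeta : 'I_n -> nat) : set A :=
  fun x => exists t, (forall k, count_mem k t = zeta k) /\ x = e_mon t.
Definition f_mons (zeta : 'I_n -> nat) : set A :=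
  fun x => exists t, (forall k, count_mem k t = zeta k) /\ x = f_mon t.
(** The weight zeta - alpha_i, stated additively: for zeta_i = 0 the set is empty, which forces both
    skew derivatives to vanish, whereas truncated subtraction would return zeta itself. *)
Definition e_mons_below (zeta : 'I_n -> nat) i : set A :=
  fun x => exists t, (forall k, zeta k = (i == k) + count_mem k t)%N /\ x = e_mon t.

Lemma lin_span_e_Bpos zeta x : lin_span (e_mons zeta) x -> Bpos x.
Proof.
by apply: lin_span_sub => // y [t [_ ->]]; exact: e_mon_Bpos.
Qed.

Lemma lin_span_f_Bneg zeta x : lin_span (f_mons zeta) x -> Bneg x.
Proof.
by apply: lin_span_sub => // y [t [_ ->]]; exact: f_mon_Bneg.
Qed.

Lemma e_mons_belowS zeta i x :
  e_mons_below zeta i x -> zeta i = 0%N -> False.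
Proof. by move=> [t [/(_ i) -> _]]; rewrite eqxx. Qed.

Lemma lin_span_below_Bpos zeta i x : lin_span (e_mons_below zeta i) x -> Bpos x.
Proof.
by apply: lin_span_sub => // y [t [_ ->]]; exact: e_mon_Bpos.
Qed.

(* The two skew derivations of x, read off from the commutator with f_i, are   *)
(* adjoint to right and left multiplication by f_i.                            *)
Definition skew_derivatives zeta i x a b :=
  [/\ lin_span (e_mons_below zeta i) a, lin_span (e_mons_below zeta i) b,
      x ** f i - f i ** x = w' i ** b - a ** w i &
      forall zeta' y, lin_span (f_mons zeta') y ->
        pair (y ** f i) x = pair y a /\ pair (f i ** y) x = pair y b].

Lemma pair_f_span_mul_w zeta y a i : Bpos a -> lin_span (f_mons zeta) y ->
  pair y (a ** w i) = pair y a.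
Proof.
move=> Ba Sy.
suff [] : Bneg y /\ pair y (a ** w i) = pair y a by [].
move: y Sy; apply: lin_span_sub.
- by split=> //; rewrite !pair0l //; exact: BposM.
- move=> c x y [Bx Ex] [By Ey]; split; first exact: BnegL.
  by rewrite !pair_linl // ?Ex ?Ey //; exact: BposM.
- by move=> x [t [_ ->]]; split; [exact: f_mon_Bneg|exact: pair_f_mon_mul_w].
Qed.

(** Existence passes from words to their linear combinations without any check that [e_derR] and
    [e_derL] respect relations between words. Membership in [Bpos] is carried along because the
    pairing is bilinear only there. *)
Lemma skew_derivatives_ex zeta i x : lin_span (e_mons zeta) x ->
  exists a b, skew_derivatives zeta i x a b.
Proof.
move=> Sx; suff [] : Bpos x /\ exists a b, skew_derivatives zeta i x a b by [].
move: x Sx; apply: lin_span_sub.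
- split=> //; exists 0, 0; split; try exact: lin_span0.
    by rewrite !mulv0 !mul0v !subrr.
  move=> z y /lin_span_f_Bneg By; rewrite !pair0r //; exact: BnegM.
- move=> c x y [Bx [ax [bx [Sax Sbx Cx Px]]]] [By [ay [yb [Say Sby Cy Py]]]].
  split; first exact: BposL.
  exists (c *: ax + ay), (c *: bx + yb); split; try exact: lin_span_lin.
    rewrite !mulDl !mulDr !mulZl !mulZr opprD addrACA -scalerBr Cx Cy.
    by rewrite scalerBr opprD addrACA.
  move=> z y' Sy'; have By' := lin_span_f_Bneg Sy'.
  have [E1 E2] := Px _ _ Sy'; have [E3 E4] := Py _ _ Sy'.
  have Bax := lin_span_below_Bpos Sax; have Bay := lin_span_below_Bpos Say.
  have Bbx := lin_span_below_Bpos Sbx; have Bby := lin_span_below_Bpos Sby.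
  by rewrite !pair_linr ?E1 ?E2 ?E3 ?E4 //; exact: BnegM.
move=> x [t [tz ->]]; split; first exact: e_mon_Bpos.
have below y : e_without i t y -> lin_span (e_mons_below zeta i) y.
  move=> [t' [/permP tt' ->]]; apply: lin_span_incl; exists t'; split=> // k.
  by rewrite -tz tt'.
exists (e_derR i t), (e_derL i t).
have Sa : lin_span (e_mons_below zeta i) (e_derR i t).
  by move: (e_derR_span i t); apply: lin_span_sub => //;
    [exact: lin_span0|move=> *; exact: lin_span_lin].
have Sb : lin_span (e_mons_below zeta i) (e_derL i t).
  by move: (e_derL_span i t); apply: lin_span_sub => //;
    [exact: lin_span0|move=> *; exact: lin_span_lin].
split=> //; first exact: e_mon_commutator.
move=> z y Sy; have By := lin_span_f_Bneg Sy.
rewrite pair_mulf_e_mon // pair_fmul_e_mon //.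
by rewrite (pair_f_span_mul_w _ _ Sy) //; exact: lin_span_below_Bpos Sa.
Qed.

(** * Dual bases and their canonical elements *)

Variables (d : {ffun 'I_n -> nat} -> nat).
Variables (u v : forall zeta, 'I_(d zeta) -> A).
Implicit Type zeta : {ffun 'I_n -> nat}.
Hypothesis u_basis : forall zeta,
  basis_of_set (lin_span (e_mons zeta)) (u (zeta := zeta)).
Hypothesis v_basis : forall zeta,
  basis_of_set (lin_span (f_mons zeta)) (v (zeta := zeta)).
Hypothesis uv_dual : forall zeta (k l : 'I_(d zeta)), pair (v k) (u l) = (k == l)%:R.

Lemma u_Bpos zeta (k : 'I_(d zeta)) : Bpos (u k).
Proof. by have [+ _] := u_basis zeta => /(_ k) /lin_span_e_Bpos. Qed.
Lemma v_Bneg zeta (k : 'I_(d zeta)) : Bneg (v k).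
Proof. by have [+ _] := v_basis zeta => /(_ k) /lin_span_f_Bneg. Qed.
Hint Resolve u_Bpos v_Bneg : core.

Lemma u_expand zeta x : lin_span (e_mons zeta) x ->
  x = \sum_(k < d zeta) pair (v k) x *: u k.
Proof.
move=> Sx; have [_ /(_ x Sx) [c [{Sx}-> _]]] := u_basis zeta.
apply: eq_bigr => k _; congr (_ *: _).
have [|-> _] := pair_sumr (l := index_enum 'I_(d zeta)) c
  (g := fun k => u k) (v_Bneg k); first by [].
rewrite (bigD1_seq k) ?mem_index_enum ?index_enum_uniq //= uv_dual eqxx mulr1.
rewrite big1 ?addr0 // => l /negPf lk.
by rewrite uv_dual eq_sym lk mulr0.
Qed.

Lemma v_expand zeta x : lin_span (f_mons zeta) x ->
  x = \sum_(k < d zeta) pair x (u k) *: v k.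
Proof.
move=> Sx; have [_ /(_ x Sx) [c [{Sx}-> _]]] := v_basis zeta.
apply: eq_bigr => k _; congr (_ *: _).
have [|-> _] := pair_suml (l := index_enum 'I_(d zeta)) c
  (g := fun k => v k) (u_Bpos k); first by [].
rewrite (bigD1_seq k) ?mem_index_enum ?index_enum_uniq //= uv_dual eqxx mulr1.
rewrite big1 ?addr0 // => l /negPf lk.
by rewrite uv_dual lk mulr0.
Qed.

Section Transfer.
Variables (W : lmodType K) (B : A -> A -> W).
Hypothesis Bl : forall c x y z, B (c *: x + y) z = c *: B x z + B y z.
Hypothesis Br : forall c x y z, B z (c *: x + y) = c *: B z x + B z y.

Lemma bilin_suml I (l : seq I) (c : I -> K) g z :
  B (\sum_(k <- l) c k *: g k) z = \sum_(k <- l) c k *: B (g k) z.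
Proof.
have B0 : B 0 z = 0.
  have := Bl 1 0 0 z; rewrite !scale1r addr0 => /esym /eqP.
  by rewrite -subr_eq0 addrK => /eqP.
by elim: l => [|k l IHl]; rewrite ?big_nil // !big_cons Bl IHl.
Qed.

Lemma bilin_sumr I (l : seq I) (c : I -> K) g z :
  B z (\sum_(k <- l) c k *: g k) = \sum_(k <- l) c k *: B z (g k).
Proof.
have B0 : B z 0 = 0.
  have := Br 1 0 0 z; rewrite !scale1r addr0 => /esym /eqP.
  by rewrite -subr_eq0 addrK => /eqP.
by elim: l => [|k l IHl]; rewrite ?big_nil // !big_cons Br IHl.
Qed.

(* The canonical element of a pairing carries an operator on one side to its   *)
(* adjoint on the other side.                                                  *)
Lemma canonical_transfer zeta zeta' (a : 'I_(d zeta) -> A) (g : A -> A) :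
  (forall k, lin_span (e_mons zeta') (a k)) ->
  (forall l : 'I_(d zeta'), lin_span (f_mons zeta) (g (v l))) ->
  (forall k (l : 'I_(d zeta')), pair (g (v l)) (u k) = pair (v l) (a k)) ->
  \sum_k B (v k) (a k) = \sum_(l < d zeta') B (g (v l)) (u l).
Proof.
move=> Sa Sg adj.
transitivity (\sum_k \sum_(l < d zeta') pair (v l) (a k) *: B (v k) (u l)).
  by apply: eq_bigr => k _; rewrite {1}(u_expand (Sa k)) bilin_sumr.
rewrite exchange_big /=; apply: eq_bigr => l _.
rewrite [in RHS](v_expand (Sg l)) bilin_suml.
by apply: eq_bigr => k _; rewrite adj.
Qed.

End Transfer.

Variables (N : nat) (rho : A -> 'M[K]_N).
Hypothesis rhoL : forall c x y, rho (c *: x + y) = c *: rho x + rho y.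
Hypothesis rhoM : forall x y, rho (x ** y) = rho x *m rho y.
Hypothesis rho1 : rho one = 1%:M.

Lemma tensmx_linl m1 n1 m2 n2 c (M M' : 'M[K]_(m1, n1)) (P : 'M[K]_(m2, n2)) :
  (c *: M + M') *t P = c *: (M *t P) + M' *t P.
Proof. by apply/matrixP => i j; rewrite !mxE mulrDl mulrA. Qed.

Lemma tensmx_linr m1 n1 m2 n2 c (M M' : 'M[K]_(m1, n1)) (P : 'M[K]_(m2, n2)) :
  P *t (c *: M + M') = c *: (P *t M) + P *t M'.
Proof. by apply/matrixP => i j; rewrite !mxE mulrDr mulrCA. Qed.

Definition theta zeta := \sum_(k < d zeta) (rho (v k) *t rho (u k)).

Definition lower zeta i : {ffun 'I_n -> nat} := [ffun k => (zeta k - (i == k))%N].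

Lemma e_mons_below_eq0 zeta i x : zeta i = 0%N ->
  lin_span (e_mons_below zeta i) x -> x = 0.
Proof.
move=> z0; apply: (@lin_span_sub _ _ _ (fun x => x = 0)) => //.
  by move=> c y z -> ->; rewrite scaler0 addr0.
by move=> y /e_mons_belowS/(_ z0).
Qed.

Lemma e_mons_below_lower zeta i x : (0 < zeta i)%N ->
  lin_span (e_mons_below zeta i) x -> lin_span (e_mons (lower zeta i)) x.
Proof.
move=> z0; apply: lin_span_sub; first exact: lin_span0.
  by move=> *; exact: lin_span_lin.
move=> y [t [tz ->]]; apply: lin_span_incl; exists t; split=> // k.
by rewrite ffunE tz addKn.
Qed.

Lemma count_lower zeta i (t : seq 'I_n) : (0 < zeta i)%N ->
  (forall k, count_mem k t = lower zeta i k) ->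
  forall k, ((i == k) + count_mem k t = zeta k)%N.
Proof.
move=> z0 tz k; rewrite tz ffunE subnKC //.
by case: eqP => // <-.
Qed.

Lemma f_mons_mulr zeta i x : (0 < zeta i)%N ->
  lin_span (f_mons (lower zeta i)) x -> lin_span (f_mons zeta) (x ** f i).
Proof.
move=> z0; apply: (@lin_span_sub _ _ _ (fun x => lin_span _ (x ** f i))).
- by rewrite mul0v; exact: lin_span0.
- by move=> c y z Sy Sz; rewrite mulDl mulZl; exact: lin_span_lin.
move=> y [t [tz ->]]; apply: lin_span_incl; exists (i :: t); split=> // k.
exact: count_lower.
Qed.

Lemma f_mon_rcons t i : f_mon (rcons t i) = f i ** f_mon t.
Proof. by elim: t => [|j t /= ->]; rewrite /= ?mulv1 ?mul1v ?mulA. Qed.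

Lemma f_mons_mull zeta i x : (0 < zeta i)%N ->
  lin_span (f_mons (lower zeta i)) x -> lin_span (f_mons zeta) (f i ** x).
Proof.
move=> z0; apply: (@lin_span_sub _ _ _ (fun x => lin_span _ (f i ** x))).
- by rewrite mulv0; exact: lin_span0.
- by move=> c y z Sy Sz; rewrite mulDr mulZr; exact: lin_span_lin.
move=> y [t [tz ->]]; apply: lin_span_incl; exists (rcons t i).
rewrite f_mon_rcons; split=> // k.
by rewrite -cats1 count_cat addnC /= addn0; exact: count_lower.
Qed.

Lemma theta_commutator zeta i :
  theta zeta *m (1%:M *t rho (f i)) - (1%:M *t rho (f i)) *m theta zeta =
  if (0 < zeta i)%N then
    (rho (f i) *t rho (w' i)) *m theta (lower zeta i) -
    theta (lower zeta i) *m (rho (f i) *t rho (w i))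
  else 0.
Proof.
have rhoB x y : rho (x - y) = rho x - rho y.
  by rewrite addrC -scaleN1r rhoL scaleN1r addrC.
have /choice [ab abP] (k : 'I_(d zeta)) :
    exists ab : A * A, skew_derivatives zeta i (u k) ab.1 ab.2.
  have [+ _] := u_basis zeta => /(_ k) /(skew_derivatives_ex i) [a [b abP]].
  by exists (a, b).
have -> : theta zeta *m (1%:M *t rho (f i)) - (1%:M *t rho (f i)) *m theta zeta
    = \sum_k (rho (v k) *t (rho (w' i) *m rho (ab k).2))
    - \sum_k (rho (v k) *t (rho (ab k).1 *m rho (w i))).
  rewrite /theta mulmx_suml mulmx_sumr -!sumrB; apply: eq_bigr => k _.
  rewrite !tensmx_mul mul1mx mulmx1 -!rhoM.
  have tB (P Q R : 'M[K]_N) : P *t Q - P *t R = P *t (Q - R).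
    by rewrite addrC -scaleN1r -tensmx_linr scaleN1r addrC.
  by rewrite !tB -!rhoB; have [_ _ -> _] := abP k.
case: ltnP => [z0|]; last first.
  rewrite leqn0 => /eqP z0; rewrite !big1 ?subrr // => k _;
    have [/(e_mons_below_eq0 z0) -> /(e_mons_below_eq0 z0) -> _ _] := abP k;
    have -> : rho 0 = 0 by rewrite -(subrr one) rhoB subrr.
  - by rewrite mul0mx tensmx0.
  - by rewrite mulmx0 tensmx0.
(* The derivative b is adjoint to left multiplication by f_i, which puts [rho (f i)] on the left of
   the first leg; a is adjoint to right multiplication, which puts it on the right. *)
congr (_ - _).
  rewrite (@canonical_transfer _ (fun x y => rho x *t (rho (w' i) *m rho y))
    _ _ zeta (lower zeta i) (fun k => (ab k).2) (mul (f i))).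
  - rewrite /theta mulmx_sumr; apply: eq_bigr => l _.
    by rewrite tensmx_mul rhoM.
  - by move=> c x y z; rewrite rhoL tensmx_linl.
  - by move=> c x y z; rewrite rhoL mulmxDr -scalemxAr tensmx_linr.
  - by move=> k; have [_ /(e_mons_below_lower z0)] := abP k.
  - by move=> l; apply: f_mons_mull => //; have [+ _] := v_basis (lower zeta i).
  - move=> k l; have [_ _ _ P] := abP k.
    by have [+ _] := v_basis (lower zeta i) => /(_ l) /P[].
rewrite (@canonical_transfer _ (fun x y => rho x *t (rho y *m rho (w i)))
  _ _ zeta (lower zeta i) (fun k => (ab k).1) (mul^~ (f i))).
- rewrite /theta mulmx_suml; apply: eq_bigr => l _.
  by rewrite tensmx_mul rhoM.
- by move=> c x y z; rewrite rhoL tensmx_linl.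
- by move=> c x y z; rewrite rhoL mulmxDl -scalemxAl tensmx_linr.
- by move=> k; have [/(e_mons_below_lower z0)] := abP k.
- by move=> l; apply: f_mons_mulr => //; have [+ _] := v_basis (lower zeta i).
- move=> k l; have [_ _ _ P] := abP k.
  by have [+ _] := v_basis (lower zeta i) => /(_ l) /P[].
Qed.

Lemma e_mons0 x : lin_span (e_mons (fun=> 0%N)) x -> x = pair one x *: one.
Proof.
apply: (@lin_span_sub _ _ _ (fun x => x = pair one x *: one)).
- by rewrite pair0r // scale0r.
- move=> c y z Ey Ez; rewrite [in LHS]Ey [in LHS]Ez scalerA -scalerDl.
  have BZ c' : Bpos (c' *: one) by rewrite -[_ *: _]addr0; exact: BposL.
  by rewrite pair_linr //; [rewrite Ey|rewrite Ez]; exact: BZ.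
move=> y [t [t0 ->]]; have -> : t = [::].
  by case: t t0 => // j t /(_ j); rewrite /= eqxx.
by rewrite /= pair_1l // eps1 scale1r.
Qed.

(** The weight space of 0 is spanned by 1, so u_k = <1, u_k> 1, and the sum becomes the expansion of
    1 in the basis v_k. *)
Lemma theta0 zeta : (forall k, zeta k = 0%N) -> theta zeta = 1%:M *t 1%:M.
Proof.
move=> z0; have z0' : (zeta : 'I_n -> nat) = (fun=> 0%N) by apply: funext.
transitivity (rho (\sum_(k < d zeta) pair one (u k) *: v k) *t (1%:M : 'M[K]_N)).
  have Bl c x y (z : 'M[K]_N) :
      rho (c *: x + y) *t z = c *: (rho x *t z) + rho y *t z.
    by rewrite rhoL tensmx_linl.
  rewrite (bilin_suml (B := fun x (y : A) => rho x *t (1%:M : 'M[K]_N)) _ _ _ _ 0) //.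
  apply: eq_bigr => k _; have [+ _] := u_basis zeta => /(_ k).
  rewrite {1}z0' => /e_mons0 Eu.
  rewrite {1}Eu -[_ *: one]addr0 rhoL rho1 tensmx_linr.
  have -> : rho 0 = 0 by rewrite -(addNr one) -scaleN1r rhoL scaleN1r addNr.
  by rewrite tensmx0 addr0.
rewrite -v_expand ?rho1 // z0'; apply: lin_span_incl.
by exists [::].
Qed.

(** * Finiteness of Theta and summation over all weights *)

Variable M : nat.
Hypothesis rho_nilp : forall t, (M <= size t)%N -> rho (e_mon t) = 0.

Lemma size_sum_count t : size t = (\sum_k count_mem k t)%N.
Proof.
elim: t => [|j t IHt] /=; first by rewrite big1.
rewrite big_split /= -IHt (bigD1 j) //= eqxx big1 // => k /negPf.
by rewrite eq_sym => ->.
Qed.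

Lemma theta_eq0 zeta : (M <= \sum_k zeta k)%N -> theta zeta = 0.
Proof.
move=> Mz; rewrite /theta big1 // => k _.
suff -> : rho (u k) = 0 by rewrite tensmx0.
have [+ _] := u_basis zeta => /(_ k).
apply: (@lin_span_sub _ _ _ (fun x => rho x = 0)).
- by rewrite -(addNr one) -scaleN1r rhoL scaleN1r addNr.
- by move=> c y z Ey Ez; rewrite rhoL Ey Ez scaler0 addr0.
move=> y [t [tz ->]]; apply: rho_nilp.
by rewrite size_sum_count (eq_bigr _ (fun k _ => tz k)).
Qed.

Definition box_weight (z : {ffun 'I_n -> 'I_M.+1}) : {ffun 'I_n -> nat} :=
  [ffun k => nat_of_ord (z k)].
Definition theta_box : {fset {ffun 'I_n -> nat}} :=
  [fset box_weight z | z in predT]%fset.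

Lemma theta_boxP zeta : zeta \notin theta_box -> theta zeta = 0.
Proof.
move=> zB; apply: theta_eq0; rewrite leqNgt; apply: contra zB => Mz.
apply/imfsetP; exists [ffun k => inord (zeta k)] => //.
apply/ffunP => k; rewrite !ffunE inordK // ltnS ltnW //.
by apply: leq_ltn_trans Mz; rewrite (bigD1 k) //= leq_addr.
Qed.

Lemma theta_sum : \sum_(zeta \in [set: {ffun 'I_n -> nat}]) theta zeta =
  \sum_(zeta <- theta_box) theta zeta.
Proof. by apply: fsbigTE => zeta; exact: theta_boxP. Qed.

Definition theta_total := \sum_(zeta \in [set: {ffun 'I_n -> nat}]) theta zeta.

Definition raise zeta i : {ffun 'I_n -> nat} := [ffun k => (zeta k + (i == k))%N].

Lemma theta_total_intertwines i :
  theta_total *m (1%:M *t rho (f i) + rho (f i) *t rho (w i)) =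
  (1%:M *t rho (f i) + rho (f i) *t rho (w' i)) *m theta_total.
Proof.
pose c (X : 'M[K]_(N * N)) :=
  (rho (f i) *t rho (w' i)) *m X - X *m (rho (f i) *t rho (w i)).
pose F zeta := if (0 < zeta i)%N then c (theta (lower zeta i)) else 0.
suff E : theta_total *m (1%:M *t rho (f i)) - (1%:M *t rho (f i)) *m theta_total
    = c theta_total.
  apply/eqP; rewrite mulmxDr mulmxDl -subr_eq0 opprD addrACA E /c.
  by rewrite -[X in X + _]opprB addNr.
have -> : theta_total *m (1%:M *t rho (f i)) - (1%:M *t rho (f i)) *m theta_total
    = \sum_(zeta <- theta_box) F zeta.
  rewrite /theta_total theta_sum mulmx_suml mulmx_sumr -sumrB.
  by apply: eq_bigr => zeta _; rewrite theta_commutator.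
(* [F zeta] is itself the commutator of [theta zeta] with 1 (x) f_i, so it vanishes outside the box
   even where [lower zeta i] lies inside. *)
rewrite -fsbigTE; last first.
  move=> zeta /theta_boxP z0; rewrite /F.
  by have := theta_commutator zeta i; rewrite z0 mul0mx mulmx0 subrr => <-.
transitivity (\sum_(zeta \in [set: {ffun 'I_n -> nat}]) c (theta zeta)).
  transitivity (\sum_(zeta \in [set z : {ffun 'I_n -> nat} | (0 < z i)%N]%classic)
      c (theta (lower zeta i))).
    rewrite [RHS]fsbig_mkcond; apply: eq_fsbigr => zeta _.
    by rewrite /F /functions.patch mem_setE.
  (* The weights with zeta_i > 0 are exactly the xi + alpha_i, with xi arbitrary. *)
  rewrite (reindex_fsbig (raise^~ i) setT); last first.
    split.
    - by move=> zeta _ /=; rewrite ffunE eqxx addn1.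
    - move=> z1 z2 _ _ /ffunP E; apply/ffunP => k.
      by have := E k; rewrite !ffunE => /addIn.
    - move=> zeta /= z0; exists (lower zeta i) => //.
      apply/ffunP => k; rewrite !ffunE subnK //.
      by case: eqP => // <-.
  apply: eq_fsbigr => zeta _; congr (c (theta _)).
  by apply/ffunP => k; rewrite !ffunE addnK.
rewrite (fsbigTE theta_box); last first.
  by move=> zeta /theta_boxP ->; rewrite /c mul0mx mulmx0 subrr.
by rewrite /theta_total theta_sum /c mulmx_suml mulmx_sumr -sumrB.
Qed.

(** A nonempty word in the e's applies its rightmost letter to h first and so kills it; only the
    term zeta = 0 is left. *)
Lemma theta_total_highest m (x : 'M[K]_(N, m)) (h : 'cV[K]_N) :
  (forall i, rho (e i) *m h = 0) -> theta_total *m (x *t h) = x *t h.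
Proof.
move=> eh; pose z0 : {ffun 'I_n -> nat} := [ffun=> 0%N].
have z0B : z0 \in theta_box.
  apply/imfsetP; exists [ffun=> ord0] => //.
  by apply/ffunP => k; rewrite !ffunE.
rewrite /theta_total theta_sum (bigD1_seq z0) ?fset_uniq //= mulmxDl.
rewrite theta0; last by move=> k; rewrite ffunE.
rewrite tensmx_mul !mul1mx mulmx_suml big1 ?addr0 // => zeta zn0.
rewrite /theta mulmx_suml big1 // => k _; rewrite tensmx_mul.
suff -> : rho (u k) *m h = 0 by rewrite tensmx0.
have [+ _] := u_basis zeta => /(_ k).
apply: (@lin_span_sub _ _ _ (fun x => rho x *m h = 0)).
- have -> : rho 0 = 0 by rewrite -(addNr one) -scaleN1r rhoL scaleN1r addNr.
  by rewrite mul0mx.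
- by move=> c y z Ey Ez; rewrite rhoL mulmxDl -scalemxAl Ey Ez scaler0 addr0.
move=> y [[|j t] [tz ->]] /=; last by rewrite rhoM -mulmxA eh mulmx0.
by case/eqP: zn0; apply/ffunP => l; rewrite ffunE -tz.
Qed.

End Pairing.

(** * Coefficients of the braiding *)

(** A comparison that the context does not decide becomes an arbitrary boolean: the identities to
    which this is applied hold for either value. *)
Ltac decide_bool b :=
  first [ have -> : b = true by lia | have -> : b = false by lia
        | generalize b; intro ].

Ltac decide_eqs :=
  repeat match goal with
  | |- context [@eq_op ?T ?m ?k] => decide_bool (@eq_op T m k)
  end.

Ltac decide_bools :=
  decide_eqs;
  repeat match goal with |- context [leq ?m ?k] => decide_bool (leq m k) end.

Ltac split_ifs :=
  repeat (case: ifP; move=> ?; try (exfalso; lia)).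

Section Scalars.
Set Implicit Arguments.
Unset Strict Implicit.
Variables (n : nat) (K : fieldType) (rh sh : K).
Hypotheses (n_ge4 : (4 <= n)%N) (rh0 : rh != 0) (sh0 : sh != 0).
Local Notation bar := (prime_idx n).
Local Notation r := (rh ^+ 2).
Local Notation s := (sh ^+ 2).
Local Notation q := (rh^-1 * sh).
Local Notation t := ((rh * sh)^-1).

(** For weights +-epsilon_i of v_a and +-epsilon_j of v_b with i != j, this says that the signs
    agree and i < j, or that they differ and i > j. *)
Definition braid_sign (a b : nat) : bool :=
  [|| (a < b <= n)%N, (n < b < a)%N, (a <= n < b)%N && (2 * n + 1 < a + b)%N
    | (b <= n < a)%N && (a + b < 2 * n + 1)%N].

(* The value of f on the weights of v_a and v_b. *)
Definition braid_coef (a b : nat) : K :=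
  if a == b then q else if a == bar b then q^-1
  else if braid_sign a b then t else t^-1.

(* The eigenvalue of w_i (below: of w'_i) on v_k. *)
Definition w_val (i k : nat) : K :=
  if (i < n)%N then
    if k == i then r else if k == i.+1 then s
    else if k == (bar i.+1) then s^-1 else if k == (bar i) then r^-1 else 1
  else
    if k == (n - 1)%N then s^-1 else if k == n then r
    else if k == (bar n) then r^-1 else if k == (bar (n - 1)) then s
    else if (k <= n - 2)%N then r^-1 * s^-1 else r * s.

Definition w'_val (i k : nat) : K :=
  if (i < n)%N then
    if k == i then s else if k == i.+1 then r
    else if k == (bar i.+1) then r^-1 else if k == (bar i) then s^-1 else 1
  else
    if k == (n - 1)%N then r^-1 else if k == n then s
    else if k == (bar n) then s^-1 else if k == (bar (n - 1)) then r
    else if (k <= n - 2)%N then r^-1 * s^-1 else r * s.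

(* f_i v_k = f_val i k v_(f_to i k); f_to is only meaningful when f_val i k is  *)
(* nonzero.                                                                    *)
Definition f_to (i k : nat) : nat := if (i < n)%N then k.+1 else k.+2.
Definition f_val (i k : nat) : K :=
  if (i < n)%N then (k == i)%:R - t * (k == bar i.+1)%:R
  else (k == n)%:R - t * (k == n.-1)%:R.

Definition rho_pow (k : nat) : K := q ^ rho_idx n k.

Lemma q_neq0 : q != 0.
Proof. by rewrite mulf_neq0 ?invr_neq0. Qed.

Variant f_spec (i k : nat) : K -> nat -> Prop :=
| FSpecLow of (i < n)%N & k = i : f_spec i k 1 i.+1
| FSpecHigh of (i < n)%N & k = bar i.+1 : f_spec i k (- t) (bar i)
| FSpecN of i = n & k = n : f_spec i k 1 n.+2
| FSpecN' of i = n & k = n.-1 : f_spec i k (- t) n.+1.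

Lemma f_valP i k : (1 <= i <= n)%N -> f_val i k != 0 ->
  f_spec i k (f_val i k) (f_to i k).
Proof.
move=> i_n; rewrite /f_val /f_to; case: ltnP => i_lt.
  have [->|ki] := eqVneq k i; have [kb|kb] := eqVneq _ (bar i.+1) => /= H.
  - by exfalso; move: kb; rewrite /prime_idx; lia.
  - by rewrite mulr0 subr0; apply: FSpecLow.
  - have -> : k.+1 = bar i by rewrite kb /prime_idx; lia.
    by rewrite mulr1 sub0r; apply: FSpecHigh.
  - by move: H; rewrite mulr0 subr0 eqxx.
have [->|ki] := eqVneq k n; have [kb|kb] := eqVneq _ n.-1 => /= H.
- by exfalso; lia.
- by rewrite mulr0 subr0; apply: FSpecN; lia.
- have -> : k.+2 = n.+1 by lia.
  by rewrite mulr1 sub0r; apply: FSpecN'; lia.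
- by move: H; rewrite mulr0 subr0 eqxx.
Qed.

(** Conceptually, f(lambda - alpha_i, mu) = f(lambda, mu) <w'_mu, w_i>, and <w'_mu, w_i> is the
    eigenvalue of w_i on weight mu. With the next lemma this is what makes f~ P carry G_i' to
    G_i. *)
Lemma braid_coef_f_l i a b : (1 <= i <= n)%N -> (1 <= a <= 2 * n)%N ->
  f_val i b != 0 -> braid_coef (f_to i b) a = braid_coef b a * w_val i a.
Proof.
move=> i_n a_n /(f_valP i_n) H.
rewrite /braid_coef /w_val /braid_sign.
case: H => [i_lt ->|i_lt ->|-> ->|-> ->].
all: rewrite ?i_lt ?ltnn /prime_idx.
all: split_ifs.
all: by field; rewrite ?rh0 ?sh0 ?oner_eq0.
Qed.

(** Here f(lambda, mu - alpha_i) = f(lambda, mu) <w'_i, w_lambda>, and w'_i acts on weight lambda by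
    the inverse of <w'_i, w_lambda>. *)
Lemma braid_coef_f_r i a b : (1 <= i <= n)%N -> (1 <= b <= 2 * n)%N ->
  f_val i a != 0 -> w'_val i b * braid_coef b (f_to i a) = braid_coef b a.
Proof.
move=> i_n a_n /(f_valP i_n) H.
rewrite /braid_coef /w'_val /braid_sign.
case: H => [i_lt ->|i_lt ->|-> ->|-> ->].
all: rewrite ?i_lt ?ltnn /prime_idx.
all: split_ifs.
all: by field; rewrite ?rh0 ?sh0 ?oner_eq0.
Qed.

Local Notation kappa := (q - q^-1).
(* D a b stands for a coordinate of v_a (x) v_b, and T b for the same coordinate *)
(* of the sum of q^(rho_k) v_k (x) v_k' over k > b.                              *)
Variables (D : nat -> nat -> K) (T : nat -> K).
Hypothesis T_rec : forall b, (b < 2 * n)%N ->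
  T b = T b.+1 + rho_pow b.+1 * D b.+1 (bar b.+1).

(* The image of T b under 1 (x) f_i + f_i (x) w'_i: the four summands, two for    *)
(* each tensor factor, that f_i does not kill.                                   *)
Definition tail_f (i b : nat) : K :=
  if (i < n)%N then
    (b < bar i)%:R * rho_pow (bar i) * D (bar i) i.+1
    - t * (b < i.+1)%:R * rho_pow i.+1 * D i.+1 (bar i)
    + s^-1 * (b < i)%:R * rho_pow i * D i.+1 (bar i)
    - t * r * (b < bar i.+1)%:R * rho_pow (bar i.+1) * D (bar i) i.+1
  else
    (b < n.+1)%:R * rho_pow n.+1 * D n.+1 n.+2
    - t * (b < n.+2)%:R * rho_pow n.+2 * D n.+2 n.+1
    + s^-1 * (b < n)%:R * rho_pow n * D n.+2 n.+1
    - t * r * (b < n.-1)%:R * rho_pow n.-1 * D n.+1 n.+2.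

(* The commutator of the explicit braiding with 1 (x) f_i + f_i (x) w'_i, on      *)
(* v_a (x) v_b.                                                                  *)
Definition commutator_coef (i a b : nat) : K :=
  f_val i b * braid_coef b a * (w_val i a - w'_val i a) * D (f_to i b) a
  + kappa * (f_val i b * ((f_to i b < a)%:R - (b < a)%:R) * D a (f_to i b)
    + w'_val i b * f_val i a * ((b < f_to i a)%:R - (b < a)%:R) * D (f_to i a) b)
  - kappa * (f_val i b * (a == bar (f_to i b))%:R * (rho_pow (f_to i b))^-1
               * T (f_to i b)
    + w'_val i b * f_val i a * (f_to i a == bar b)%:R * (rho_pow b)^-1 * T b
    - (a == bar b)%:R * (rho_pow b)^-1 * tail_f i b).

Lemma rho_pow_neq0 k : rho_pow k != 0.
Proof. exact/expfz_neq0/q_neq0. Qed.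

Lemma rho_powS k : (1 <= k < 2 * n)%N -> k != n ->
  rho_pow k = q * rho_pow k.+1.
Proof.
move=> k1 kn; rewrite /rho_pow.
have -> : rho_idx n k = 1 + rho_idx n k.+1 by rewrite /rho_idx; split_ifs; lia.
by rewrite expfzDr ?q_neq0 ?expr1z.
Qed.

Lemma rho_pow_bar k : (1 <= k <= 2 * n)%N -> rho_pow (bar k) = (rho_pow k)^-1.
Proof.
move=> k1; rewrite /rho_pow invr_expz; congr (_ ^ _).
rewrite /rho_idx /prime_idx; split_ifs; lia.
Qed.

Lemma rho_pow_n : rho_pow n = 1.
Proof. by rewrite /rho_pow /rho_idx leqnn subrr expr0z. Qed.

(** In [commutator_coef] the first summand is the defect of f~ P, the next two are the commutator
    with L, the last three that with Q. Only the positions of a and b relative to i, i+1, (i+1)', i'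
    matter, which leaves 25 identities, linear in the values of [D] and [T]. *)
Lemma commutator_coef_lt i a b : (1 <= i < n)%N -> (1 <= a <= 2 * n)%N ->
  (1 <= b <= 2 * n)%N -> commutator_coef i a b = 0.
Proof.
move=> i_n a_n b_n.
have i_lt : (i < n)%N = true by lia.
(* Opaque names for i+1, (i+1)' and i', ordered i < x2 < x3 < x4, so that the case distinctions see
   atoms. *)
have [x4 ex4] : exists x, bar i = x by exists (bar i).
have [x3 ex3] : exists x, bar i.+1 = x by exists (bar i.+1).
have [x2 ex2] : exists x, i.+1 = x by exists i.+1.
have x43 : x4 = x3.+1 by rewrite -ex4 -ex3 /prime_idx; lia.
have x23 : (x2 < x3 <= 2 * n)%N by rewrite -ex3 -ex2 /prime_idx; lia.
have b2 : bar x2 = x3 by rewrite -ex2.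
have b3 : bar x3 = x2 by rewrite -ex3 -ex2 /prime_idx; lia.
have b4 : bar x4 = i by rewrite -ex4 /prime_idx; lia.
have bE : bar b = (2 * n + 1 - b)%N by [].
have x3E : x3 = (2 * n - i)%N by rewrite -ex3 /prime_idx; lia.
have [Z r1] : exists x, rho_pow i = x by exists (rho_pow i).
have Z0 : Z != 0 by rewrite -r1 rho_pow_neq0.
have r2 : rho_pow x2 = q^-1 * Z.
  by rewrite -ex2 -r1 (@rho_powS i) ?mulKf ?q_neq0 //; lia.
have r3 : rho_pow x3 = q * Z^-1.
  by rewrite -b2 rho_pow_bar ?r2 ?invfM ?invrK //; lia.
have r4 : rho_pow x4 = Z^-1 by rewrite -ex4 rho_pow_bar ?r1 //; lia.
(* The consecutive indices i, x2 and x3, x4 link their tails; between the two pairs the tails stay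
   independent. *)
have T1 : T i = T x2 + q^-1 * Z * D x2 x3.
  by rewrite T_rec ?ex2 ?b2 ?r2 //; lia.
have T3 : T x3 = T x4 + Z^-1 * D x4 i.
  by rewrite T_rec -?x43 ?b4 ?r4 //; lia.
have to1 : f_to i i = x2 by rewrite /f_to i_lt.
have to3 : f_to i x3 = x4 by rewrite /f_to i_lt.
have [f1 f2 f3 f4] : [/\ f_val i i = 1, f_val i x2 = 0, f_val i x3 = - t
    & f_val i x4 = 0].
  by rewrite /f_val i_lt ex3; split; decide_bools;
    rewrite ?(mulr0, mulr1, subr0, sub0r, oppr0).
have f_other k : k != i -> k != x3 -> f_val i k = 0.
  by move=> /negPf k1 /negPf k3; rewrite /f_val i_lt ex3 k1 k3 mulr0 subr0.
have [w1 w2 w3 w4] : [/\ w_val i i = r, w_val i x2 = s, w_val i x3 = s^-1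
    & w_val i x4 = r^-1].
  by rewrite /w_val i_lt ex3 ex2 ex4; split; decide_bools.
have [w'1 w'2 w'3 w'4] : [/\ w'_val i i = s, w'_val i x2 = r, w'_val i x3 = r^-1
    & w'_val i x4 = s^-1].
  by rewrite /w'_val i_lt ex3 ex2 ex4; split; decide_bools.
have w_other k : k != i -> k != x2 -> k != x3 -> k != x4 ->
    w_val i k = 1 /\ w'_val i k = 1.
  move=> /negPf k1 /negPf k2 /negPf k3 /negPf k4.
  by rewrite /w_val /w'_val i_lt ex3 ex2 ex4 k1 k2 k3 k4.
rewrite /commutator_coef /tail_f i_lt ex3 ex2 ex4 r1 r2 r3 r4.
have [b1|nb1] := eqVneq b i; [|have [b1|nb2] := eqVneq b x2; [|
  have [b1|nb3] := eqVneq b x3; [|have [b1|nb4] := eqVneq b x4]]].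
all: have [a1|na1] := eqVneq a i; [|have [a1|na2] := eqVneq a x2; [|
  have [a1|na3] := eqVneq a x3; [|have [a1|na4] := eqVneq a x4]]].
all: rewrite ?a1 ?b1 ?b2 ?b3 ?b4 ?ex4.
(* There are five goals for each position of b. In the last block b is none of the four indices, in
   every fifth goal a is none of them; f_i kills the corresponding vector. *)
21-25: rewrite (f_other b) //; have [_ ->] := w_other b nb1 nb2 nb3 nb4.
5,10,15,20,25: rewrite (f_other a) //; have [-> ->] := w_other a na1 na2 na3 na4.
all: rewrite ?(f1, f2, f3, f4, w1, w2, w3, w4, w'1, w'2, w'3, w'4, to1, to3).
all: rewrite ?(subrr, mul0r, mulr0, add0r, subr0, addr0, b2, b4).
all: clear to1 to3 f1 f2 f3 f4 f_other w1 w2 w3 w4 w'1 w'2 w'3 w'4 w_other T_rec.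
all: rewrite /braid_coef ?b2 ?b3 ?b4 ?ex4 /braid_sign.
all: decide_eqs; rewrite /= ?(mulr0n, mulr1n, mul0r, mulr0, subr0,
  sub0r, oppr0, add0r, addr0).
(* Mentioning [nb4] fails unless b avoids all four indices, which restricts the step to those goals;
   there b lies on the same side of two adjacent indices. Likewise for a with [na4]. *)
all: try (have _ := nb4; have -> : (b < x2)%N = (b < i)%N by lia).
all: try (have _ := nb4; have -> : (b < x4)%N = (b < x3)%N by lia).
all: try (have _ := na4; have -> : (x2 < a)%N = (i < a)%N by lia).
all: try (have _ := na4; have -> : (x4 < a)%N = (x3 < a)%N by lia).
all: decide_bools; rewrite ?T1 ?T3 ?r1 ?r2 ?r3 ?r4 /=.
all: by field; rewrite ?rh0 ?sh0 ?Z0 ?oner_eq0 ?rho_pow_neq0.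
Qed.

(** The four indices n-1, n, n+1, n+2 are now consecutive, so all tails reduce to the one at n+2. On
    the other basis vectors w_n and w'_n act by scalars that differ from those for i < n but agree
    with each other, so the first summand still vanishes there. *)
Lemma commutator_coef_n a b : (1 <= a <= 2 * n)%N ->
  (1 <= b <= 2 * n)%N -> commutator_coef n a b = 0.
Proof.
move=> a_n b_n.
have n_lt : (n < n)%N = false by lia.
have [x1 ex1] : exists x, n.-1 = x by exists n.-1.
have [x3 ex3] : exists x, n.+1 = x by exists n.+1.
have [x4 ex4] : exists x, n.+2 = x by exists n.+2.
have ex1' : (n - 1)%N = x1 by lia.
have x21 : n = x1.+1 by lia.
have b1 : bar x1 = x4 by rewrite /prime_idx; lia.
have b2 : bar n = x3 by rewrite /prime_idx; lia.
have b3 : bar x3 = n by rewrite /prime_idx; lia.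
have b4 : bar x4 = x1 by rewrite /prime_idx; lia.
have bE : bar b = (2 * n + 1 - b)%N by [].
have r2 : rho_pow n = 1 := rho_pow_n.
have r3 : rho_pow x3 = 1 by rewrite -b2 rho_pow_bar ?r2 ?invr1 //; lia.
have r1 : rho_pow x1 = q.
  by rewrite rho_powS ?[in rho_pow _.+1]x21 -?x21 ?r2 ?mulr1 //; lia.
have r4 : rho_pow x4 = q^-1 by rewrite -b1 rho_pow_bar ?r1 //; lia.
have T3 : T x3 = T x4 + q^-1 * D x4 x1.
  by rewrite T_rec; [rewrite -ex3 ex4 r4 b4 | lia].
have T2 : T n = T x4 + q^-1 * D x4 x1 + D x3 n.
  by rewrite T_rec; [rewrite ex3 r3 b3 mul1r T3 | lia].
have T1 : T x1 = T x4 + q^-1 * D x4 x1 + D x3 n + D n x3.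
  by rewrite T_rec; [rewrite -x21 r2 b2 mul1r T2 | lia].
have to1 : f_to n x1 = x3 by rewrite /f_to n_lt; lia.
have to2 : f_to n n = x4 by rewrite /f_to n_lt; lia.
have [f1 f2 f3 f4] : [/\ f_val n x1 = - t, f_val n n = 1, f_val n x3 = 0
    & f_val n x4 = 0].
  by rewrite /f_val n_lt ex1; split; decide_bools;
    rewrite ?(mulr0, mulr1, subr0, sub0r, oppr0).
have f_other k : k != n -> k != x1 -> f_val n k = 0.
  by move=> /negPf k1 /negPf k3; rewrite /f_val n_lt ex1 k1 k3 mulr0 subr0.
have [w1 w2 w3 w4] : [/\ w_val n x1 = s^-1, w_val n n = r, w_val n x3 = r^-1
    & w_val n x4 = s].
  by rewrite /w_val n_lt ex1' b1 b2; split; decide_bools.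
have [w'1 w'2 w'3 w'4] : [/\ w'_val n x1 = r^-1, w'_val n n = s,
    w'_val n x3 = s^-1 & w'_val n x4 = r].
  by rewrite /w'_val n_lt ex1' b1 b2; split; decide_bools.
have w_other k : k != x1 -> k != n -> k != x3 -> k != x4 ->
    w_val n k = w'_val n k.
  move=> /negPf k1 /negPf k2 /negPf k3 /negPf k4.
  by rewrite /w_val /w'_val n_lt ex1' b1 b2 k1 k2 k3 k4.
rewrite /commutator_coef /tail_f n_lt ex1 ex4 ex3 r1 r2 r3 r4.
have [eb|nb1] := eqVneq b x1; [|have [eb|nb2] := eqVneq b n; [|
  have [eb|nb3] := eqVneq b x3; [|have [eb|nb4] := eqVneq b x4]]].
all: have [ea|na1] := eqVneq a x1; [|have [ea|na2] := eqVneq a n; [|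
  have [ea|na3] := eqVneq a x3; [|have [ea|na4] := eqVneq a x4]]].
all: rewrite ?ea ?eb ?b1 ?b2 ?b3 ?b4.
21-25: rewrite (f_other b) //.
5,10,15,20,25: rewrite (f_other a) // (w_other a) //.
all: rewrite ?(f1, f2, f3, f4, w1, w2, w3, w4, w'1, w'2, w'3, w'4, to1, to2).
all: rewrite ?(subrr, mul0r, mulr0, add0r, subr0, addr0, b3, b4).
all: clear to1 to2 f1 f2 f3 f4 f_other w1 w2 w3 w4 w'1 w'2 w'3 w'4 w_other T_rec.
all: rewrite /braid_coef ?b1 ?b2 ?b3 ?b4 /braid_sign.
all: decide_eqs; rewrite /= ?(mulr0n, mulr1n, mul0r, mulr0, subr0,
  sub0r, oppr0, add0r, addr0).
all: try (have _ := nb4; have -> : (b < n)%N = (b < x1)%N by lia).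
all: try (have _ := nb4; have -> : (b < x3)%N = (b < x1)%N by lia).
all: try (have _ := nb4; have -> : (b < x4)%N = (b < x1)%N by lia).
all: try (have _ := na4; have -> : (x3 < a)%N = (x1 < a)%N by lia).
all: try (have _ := na4; have -> : (x4 < a)%N = (x1 < a)%N by lia).
all: try (have _ := na4; have -> : (n < a)%N = (x1 < a)%N by lia).
all: decide_bools; rewrite ?T1 ?T2 ?T3 ?r1 ?r2 ?r3 ?r4 /=.
all: by field; rewrite ?rh0 ?sh0 ?oner_eq0 ?rho_pow_neq0.
Qed.
End Scalars.

(** * Operators on V (x) V *)

Section Matrices.
Set Implicit Arguments.
Unset Strict Implicit.

Lemma sum_nat_deltaZ (K : pzRingType) (V : lmodType K) (m p x : nat)
    (P Q : pred nat) (c : nat -> K) (G : nat -> V) : (m <= x < p)%N ->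
  \sum_(m <= k < p | P k) (c k * ((k == x) && Q k)%:R) *: G k =
  (c x * (P x && Q x)%:R) *: G x.
Proof.
move=> mxp.
rewrite big_mkcond (eq_bigr (fun k => if k == x then
  (c k * (P k && Q k)%:R) *: G k else 0)); last first.
  move=> k _; case: (k == x) => /=; last by rewrite mulr0 scale0r; case: (P k).
  by case: (P k) => //=; rewrite mulr0 scale0r.
by rewrite -big_mkcond big_nat1_eq mxp.
Qed.

Variables (n : nat) (K : fieldType).
Local Notation N := (2 * n)%N.
Local Notation bar := (prime_idx n).
Local Notation E := (@Emx n K).

Definition ev (a : nat) : 'cV[K]_N := \col_i (i.+1 == a)%:R.
Definition vv (a b : nat) := ev a *t ev b.

Lemma Emx_ev k l a : (1 <= a <= N)%N -> E k l *m ev a = (l == a)%:R *: ev k.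
Proof.
move=> a_N; have lt_a : (a.-1 < N)%N by lia.
apply/matrixP => i j; rewrite !mxE (bigD1 (Ordinal lt_a)) //= big1 ?addr0.
  by rewrite !mxE /= prednK ?eqxx ?mulr1; [rewrite -natrM mulnb andbC eq_sym|lia].
move=> k' ne; rewrite !mxE.
have -> : (k'.+1 == a) = false; last by rewrite mulr0.
apply: contra_neqF ne => /eqP E'; apply: val_inj => /=; lia.
Qed.

Lemma Emx2_vv k l m p a b : (1 <= a <= N)%N -> (1 <= b <= N)%N ->
  (E k l *t E m p) *m vv a b = ((l == a) && (p == b))%:R *: vv k m.
Proof.
move=> a_N b_N; rewrite /vv tensmx_mul !Emx_ev //.
by case: (l == a); case: (p == b); rewrite /= ?scale1r ?scale0r
  ?tens0mx ?tensmx0.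
Qed.

Lemma diag_op_ev (c : nat -> K) a : (1 <= a <= N)%N ->
  diag_op n c *m ev a = c a *: ev a.
Proof.
move=> a_N; rewrite /diag_op mulmx_suml.
rewrite (eq_bigr (fun k => (c k * ((k == a) && true)%:R) *: ev k)); last first.
  by move=> k _; rewrite -scalemxAl Emx_ev // scalerA andbT.
by rewrite sum_nat_deltaZ ?mulr1 //; lia.
Qed.

Lemma vv_mulmx m (A : 'M[K]_(m, N * N)) (i j : 'I_N) k :
  (A *m vv i.+1 j.+1) k ord0 = A k (mxtens_index (i, j)).
Proof.
rewrite mxE (bigD1 (mxtens_index (i, j))) //= big1 ?addr0.
  by rewrite !mxE mxtens_indexK !eqxx !mulr1.
move=> l ne; rewrite !mxE -[in LHS](mxtens_unindexK l).
case: (mxtens_unindex l) (mxtens_unindexK l) => i' j' El.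
rewrite mxtens_indexK /= -natrM mulnb !eqSS.
case: andP => [[/eqP/val_inj Ei /eqP/val_inj Ej]|_]; last by rewrite mulr0.
by case/eqP: ne; rewrite -El Ei Ej.
Qed.

Lemma vv_ext m (A B : 'M[K]_(m, N * N)) :
  (forall a b, (1 <= a <= N)%N -> (1 <= b <= N)%N -> A *m vv a b = B *m vv a b) ->
  A = B.
Proof.
move=> AB; apply/matrixP => k l; rewrite -(mxtens_unindexK l).
case: (mxtens_unindex l) => i j.
by rewrite -!vv_mulmx AB ?ltn_ord.
Qed.

Variables (rh sh : K).
Hypotheses (n_ge4 : (4 <= n)%N) (rh0 : rh != 0) (sh0 : sh != 0).
Local Notation r := (rh ^+ 2).
Local Notation s := (sh ^+ 2).
Local Notation q := (rh^-1 * sh).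
Local Notation t := ((rh * sh)^-1).
Local Notation kappa := (q - q^-1).
Local Notation F i := (f_mx n rh sh i).
Local Notation W i := (w_mx n r s i).
Local Notation W' i := (w'_mx n r s i).
Local Notation fv := (f_val n rh sh).
Local Notation ft := (f_to n).
Local Notation wv := (w_val n rh sh).
Local Notation wv' := (w'_val n rh sh).
Local Notation rp := (rho_pow n rh sh).
Local Notation cf := (braid_coef n rh sh).

Lemma w_mx_ev i a : (1 <= a <= N)%N -> W i *m ev a = wv i a *: ev a.
Proof. exact: diag_op_ev. Qed.

Lemma w'_mx_ev i a : (1 <= a <= N)%N -> W' i *m ev a = wv' i a *: ev a.
Proof. exact: diag_op_ev. Qed.

Lemma f_mx_ev i a : (1 <= i <= n)%N -> (1 <= a <= N)%N ->
  F i *m ev a = fv i a *: ev (ft i a).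
Proof.
move=> i_n a_N; rewrite /f_mx /f_val /f_to; case: ltnP => i_lt.
  rewrite mulmxBl -scalemxAl !Emx_ev // scalerA [_ == a]eq_sym.
  rewrite [bar i.+1 == a]eq_sym.
  have [->|ai] := eqVneq a i.
    have -> : (i == bar i.+1) = false by rewrite /prime_idx; lia.
    by rewrite /= mulr0 scale0r !subr0.
  have [->|ab] := eqVneq a (bar i.+1); last first.
    by rewrite mulr0 subr0 !scale0r subr0.
  rewrite scale0r !sub0r -scaleNr; congr (_ *: ev _).
  by rewrite /prime_idx; lia.
have -> : (n - 1)%N = n.-1 by lia.
rewrite mulmxBl -scalemxAl !Emx_ev // scalerA [n == a]eq_sym.
rewrite [n.-1 == a]eq_sym.
have [->|ai] := eqVneq a n.
  have -> : (n == n.-1) = false by lia.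
  by rewrite /= mulr0 scale0r !subr0 addn2.
have [->|ab] := eqVneq a n.-1; last first.
  by rewrite mulr0 subr0 !scale0r subr0.
rewrite scale0r !sub0r -scaleNr; congr (_ *: ev _); lia.
Qed.

Lemma f_to_range i a : (1 <= i <= n)%N -> fv i a != 0 ->
  (1 <= ft i a <= N)%N /\ (1 <= a <= N)%N.
Proof.
move=> i_n /(f_valP n_ge4 rh0 sh0 i_n) [i_lt ->|i_lt ->|_ ->|_ ->];
  rewrite /prime_idx; lia.
Qed.

Definition lowering_w' i := 1%:M *t F i + F i *t W' i.
Definition lowering_w i := 1%:M *t F i + F i *t W i.

Lemma tensmxZl m1 n1 m2 n2 c (A : 'M[K]_(m1, n1)) (B : 'M[K]_(m2, n2)) :
  (c *: A) *t B = c *: (A *t B).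
Proof. by apply/matrixP => i j; rewrite !mxE mulrA. Qed.
Lemma tensmxZr m1 n1 m2 n2 c (A : 'M[K]_(m1, n1)) (B : 'M[K]_(m2, n2)) :
  A *t (c *: B) = c *: (A *t B).
Proof. by apply/matrixP => i j; rewrite !mxE mulrCA. Qed.

Lemma lowering_w'_vv i a b : (1 <= i <= n)%N -> (1 <= a <= N)%N -> (1 <= b <= N)%N ->
  lowering_w' i *m vv a b = fv i b *: vv a (ft i b) + (wv' i b * fv i a) *: vv (ft i a) b.
Proof.
move=> i_n a_N b_N; rewrite /lowering_w' /vv mulmxDl !tensmx_mul mul1mx !f_mx_ev //.
by rewrite w'_mx_ev // tensmxZr tensmxZl tensmxZr scalerA mulrC.
Qed.

Lemma lowering_w_vv i a b : (1 <= i <= n)%N -> (1 <= a <= N)%N -> (1 <= b <= N)%N ->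
  lowering_w i *m vv a b = fv i b *: vv a (ft i b) + (wv i b * fv i a) *: vv (ft i a) b.
Proof.
move=> i_n a_N b_N; rewrite /lowering_w /vv mulmxDl !tensmx_mul mul1mx !f_mx_ev //.
by rewrite w_mx_ev // tensmxZr tensmxZl tensmxZr scalerA mulrC.
Qed.

Lemma wv'_neq0 i a : wv' i a != 0.
Proof.
by rewrite /w'_val; repeat (case: ifP => _);
  rewrite ?mulf_neq0 ?invr_neq0 ?expf_neq0 ?oner_neq0.
Qed.

(** The source is v_(a-1) except for a = n+1: because of the fork of the Dynkin diagram no lowering
    operator joins v_n to v_(n+1), and f_n reaches v_(n+1) from v_(n-1). *)
Lemma f_to_surj a : (2 <= a <= N)%N -> exists i a0,
  [/\ (1 <= i <= n)%N, (1 <= a0 < a)%N, fv i a0 != 0 & ft i a0 = a].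
Proof.
move=> a_N; have t0 : t != 0 by rewrite invr_neq0 ?mulf_neq0.
case: (ltngtP a n.+1) => [a_le|a_gt|->].
- exists a.-1, a.-1; rewrite /f_val /f_to.
  have -> : (a.-1 < n)%N by lia.
  have -> : (a.-1 == bar a.-1.+1) = false by rewrite /prime_idx; lia.
  rewrite eqxx mulr0 subr0 oner_neq0; split=> //; lia.
- exists (N + 1 - a)%N, a.-1; rewrite /f_val /f_to.
  have -> : (N + 1 - a < n)%N by lia.
  have -> : (a.-1 == N + 1 - a)%N = false by lia.
  have -> : (a.-1 == bar (N + 1 - a).+1)%N by rewrite /prime_idx; lia.
  by rewrite mulr1 sub0r oppr_eq0; split=> //; lia.
exists n, n.-1; rewrite /f_val /f_to ltnn eqxx.
have -> : (n.-1 == n) = false by lia.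
by rewrite mulr1 sub0r oppr_eq0; split=> //; lia.
Qed.

(* v_1 (x) V generates V (x) V under the lowering operators. *)
Lemma lowering_commutant_eq (Y1 Y2 : 'M[K]_(N * N)) :
  (forall i, (1 <= i <= n)%N -> Y1 *m lowering_w' i = lowering_w' i *m Y1) ->
  (forall i, (1 <= i <= n)%N -> Y2 *m lowering_w' i = lowering_w' i *m Y2) ->
  (forall b, (1 <= b <= N)%N -> Y1 *m vv 1 b = Y2 *m vv 1 b) -> Y1 = Y2.
Proof.
move=> C1 C2 E1; apply: vv_ext => a b a_N b_N.
pose Z := Y1 - Y2.
have CZ i : (1 <= i <= n)%N -> Z *m lowering_w' i = lowering_w' i *m Z.
  by move=> i_n; rewrite mulmxBl mulmxBr C1 // C2.
suff Z0 : Z *m vv a b = 0 by apply/eqP; rewrite -subr_eq0 -mulmxBl Z0.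
(* The induction on a treats all b at once: G_i' (v_a0 (x) v_b) is a nonzero multiple of v_a (x) v_b
   plus a vector of v_a0 (x) V, which Z kills by induction. *)
elim/ltn_ind: a b a_N b_N => a IH b a_N b_N.
have [->|a1] := eqVneq a 1%N; first by rewrite /Z mulmxBl E1 ?subrr.
have [|i [a0 [i_n a0_a f0 fa]]] := @f_to_surj a; first by lia.
have a0_N : (1 <= a0 <= N)%N by lia.
have := congr1 (mulmx^~ (vv a0 b)) (CZ i i_n).
have [_ lt_a] := andP a0_a.
rewrite -!mulmxA (IH a0) //.
rewrite mulmx0 lowering_w'_vv // mulmxDr -!scalemxAr fa.
have -> : fv i b *: (Z *m vv a0 (ft i b)) = 0.
  have [->|fb] := eqVneq (fv i b) 0; first by rewrite scale0r.
  by have [ftb _] := f_to_range i_n fb; rewrite (IH a0) ?scaler0.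
rewrite add0r => /eqP; rewrite scaler_eq0 mulf_eq0 (negPf f0) orbF.
by rewrite (negPf (wv'_neq0 _ _)) => /eqP.
Qed.

Definition tail b := \sum_(b.+1 <= k < N.+1) rp k *: vv k (bar k).

Lemma tail_rec b : (b < N)%N -> tail b = tail b.+1 + rp b.+1 *: vv b.+1 (bar b.+1).
Proof. by move=> bN; rewrite /tail big_ltn // addrC. Qed.

Definition tail_fv i b :=
  if (i < n)%N then
    (rp (bar i) * (b < bar i)%:R) *: vv (bar i) i.+1
    - (t * rp i.+1 * (b < i.+1)%:R) *: vv i.+1 (bar i)
    + (s^-1 * rp i * (b < i)%:R) *: vv i.+1 (bar i)
    - (t * r * rp (bar i.+1) * (b < bar i.+1)%:R) *: vv (bar i) i.+1
  else
    (rp n.+1 * (b < n.+1)%:R) *: vv n.+1 n.+2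
    - (t * rp n.+2 * (b < n.+2)%:R) *: vv n.+2 n.+1
    + (s^-1 * rp n * (b < n)%:R) *: vv n.+2 n.+1
    - (t * r * rp n.-1 * (b < n.-1)%:R) *: vv n.+1 n.+2.

(** The scalars s^-1 and r in [tail_fv] are eigenvalues of w'_i on the second factor. Where both
    conditions on b hold, the two multiples of the same tensor cancel, by the choice of rho; only
    the end of the sum near b contributes. *)
Lemma lowering_tail i b : (1 <= i <= n)%N -> (1 <= b)%N ->
  lowering_w' i *m tail b = tail_fv i b.
Proof.
move=> i_n b1; rewrite /tail mulmx_sumr.
rewrite (eq_big_nat _ _ (F2 := fun k =>
  rp k *: (fv i (bar k) *: vv k (ft i (bar k)) +
   (wv' i (bar k) * fv i k) *: vv (ft i k) (bar k)))); last first.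
  move=> k k_b; rewrite -scalemxAr lowering_w'_vv //; rewrite /prime_idx; lia.
have split x : (x <= N)%N -> forall (c : nat -> K) G,
    \sum_(b.+1 <= k < N.+1) (c k * (k == x)%:R) *: G k =
    (c x * (b < x)%:R) *: G x :> 'cV_(N * N).
  move=> x_N c G.
  have [x_b|x_b] := ltnP b x.
    have x_bN : (b.+1 <= x < N.+1)%N by rewrite x_b ltnS.
    rewrite -(sum_nat_deltaZ predT predT c G x_bN).
    by apply: eq_bigr => k _; rewrite andbT.
  rewrite mulr0 scale0r big_nat big1 // => k k_b.
  have -> : (k == x) = false by lia.
  by rewrite mulr0 scale0r.
have swap x k : (k < N.+1)%N -> (x <= N)%N -> (bar k == x) = (k == bar x).
  rewrite /prime_idx; lia.
rewrite /tail_fv; case: ifP => i_lt.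
  rewrite (eq_big_nat _ _ (F2 := fun k =>
      ((rp k * (k == bar i)%:R) *: vv k (bar k).+1
       - (t * rp k * (k == i.+1)%:R) *: vv k (bar k).+1)
     + ((wv' i (bar k) * rp k * (k == i)%:R) *: vv k.+1 (bar k)
       - (t * wv' i (bar k) * rp k * (k == bar i.+1)%:R) *: vv k.+1 (bar k)))).
    rewrite big_split /= !sumrB !split ?addrA; try (rewrite /prime_idx; lia).
    have b_i : bar (bar i) = i by rewrite /prime_idx; lia.
    have b_i1 : bar (bar i.+1) = i.+1 by rewrite /prime_idx; lia.
    have b_i' : (bar i.+1).+1 = bar i by rewrite /prime_idx; lia.
    rewrite b_i b_i1 b_i'.
    have [-> ->] : wv' i (bar i) = s^-1 /\ wv' i i.+1 = r.
      by rewrite /w'_val i_lt; split; rewrite /prime_idx; decide_bools.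
    reflexivity.
  move=> k k_b; rewrite /f_val /f_to i_lt !swap; try (rewrite /prime_idx; lia).
  have -> : bar (bar i.+1) = i.+1 by rewrite /prime_idx; lia.
  rewrite scalerDr !scalerA -!scalerBl; congr (_ *: _ + _ *: _); ring.
have -> : i = n by lia.
rewrite (eq_big_nat _ _ (F2 := fun k =>
    ((rp k * (k == n.+1)%:R) *: vv k (bar k).+2
     - (t * rp k * (k == n.+2)%:R) *: vv k (bar k).+2)
   + ((wv' n (bar k) * rp k * (k == n)%:R) *: vv k.+2 (bar k)
     - (t * wv' n (bar k) * rp k * (k == n.-1)%:R) *: vv k.+2 (bar k)))).
  rewrite big_split /= !sumrB !split ?addrA; try (rewrite /prime_idx; lia).
  have c1 : bar n.+1 = n by rewrite /prime_idx; lia.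
  have c2 : (bar n.+2) = n.-1 by rewrite /prime_idx; lia.
  have c3 : bar n = n.+1 by rewrite /prime_idx; lia.
  have c4 : bar n.-1 = n.+2 by rewrite /prime_idx; lia.
  rewrite c1 c2 c3 c4.
  have -> : n.-1.+2 = n.+1 by lia.
  have [-> ->] : wv' n n.+1 = s^-1 /\ wv' n n.+2 = r.
    by rewrite /w'_val ltnn; split; rewrite /prime_idx; decide_bools.
  reflexivity.
move=> k k_b; rewrite /f_val /f_to ltnn !swap; try (rewrite /prime_idx; lia).
have -> : bar n = n.+1 by rewrite /prime_idx; lia.
have -> : bar n.-1 = n.+2 by rewrite /prime_idx; lia.
rewrite scalerDr !scalerA -!scalerBl; congr (_ *: _ + _ *: _); ring.
Qed.

Definition braid_act (R : 'M[K]_(N * N)) := forall a b,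
  (1 <= a <= N)%N -> (1 <= b <= N)%N ->
  R *m vv a b = cf b a *: vv b a + (kappa * (b < a)%:R) *: vv a b
                - (kappa * (a == bar b)%:R * (rp b)^-1) *: tail b.

Lemma braid_act_commutes R i : braid_act R -> (1 <= i <= n)%N ->
  R *m lowering_w' i = lowering_w' i *m R.
Proof.
move=> RE i_n; apply: vv_ext => a b a_N b_N.
(* If f_i kills v_b, the index [ft i b] may leave the range; the action formula is therefore used
   only under a coefficient that is 0 in that case. *)
have Rf c a' b' : (c != 0 -> (1 <= a' <= N)%N /\ (1 <= b' <= N)%N) ->
    c *: (R *m vv a' b') = c *: (cf b' a' *: vv b' a'
      + (kappa * (b' < a')%:R) *: vv a' b'
      - (kappa * (a' == bar b')%:R * (rp b')^-1) *: tail b').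
  move=> H; have [->|/H[a'N b'N]] := eqVneq c 0; first by rewrite !scale0r.
  by rewrite RE.
have fb : fv i b != 0 -> (1 <= a <= N)%N /\ (1 <= ft i b <= N)%N.
  by move/(f_to_range i_n) => [].
have fa : wv' i b * fv i a != 0 -> (1 <= ft i a <= N)%N /\ (1 <= b <= N)%N.
  by rewrite mulf_eq0 (negPf (wv'_neq0 _ _)) => /(f_to_range i_n)[].
rewrite -mulmxA lowering_w'_vv // mulmxDr -!scalemxAr Rf // Rf //.
rewrite -mulmxA RE // mulmxBr mulmxDr -!scalemxAr !lowering_w'_vv //.
rewrite lowering_tail //; last lia.
have cl : fv i b * cf (ft i b) a = fv i b * (cf b a * wv i a).
  have [->|f0] := eqVneq (fv i b) 0; first by rewrite !mul0r.
  by rewrite (braid_coef_f_l n_ge4 rh0 sh0 i_n a_N f0).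
have cr : wv' i b * fv i a * cf b (ft i a) = fv i a * cf b a.
  have [->|f0] := eqVneq (fv i a) 0; first by rewrite mulr0 !mul0r.
  by rewrite -(braid_coef_f_r n_ge4 rh0 sh0 i_n b_N f0); ring.
apply/matrixP => k l.
have mxD (A B : 'M[K]_(N * N, 1 * 1)) : (A + B) k l = A k l + B k l by rewrite mxE.
have mxN (A : 'M[K]_(N * N, 1 * 1)) : (- A) k l = - A k l by rewrite mxE.
have mxZ c (A : 'M[K]_(N * N, 1 * 1)) : (c *: A) k l = c * A k l by rewrite mxE.
have := @commutator_coef_lt n K rh sh n_ge4 rh0 sh0 (fun x y => vv x y k l)
  (fun x => tail x k l) _ i a b.
have := @commutator_coef_n n K rh sh n_ge4 rh0 sh0 (fun x y => vv x y k l)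
  (fun x => tail x k l) _ a b.
set D := fun x y => vv x y k l; set T := fun x => tail x k l.
have T_rec b' : (b' < N)%N -> T b' = T b'.+1 + rp b'.+1 * D b'.+1 (bar b'.+1).
  by move=> b'N; rewrite /T tail_rec // mxD mxZ.
move=> /(_ T_rec a_N b_N) En /(_ T_rec) Elt.
have : commutator_coef n rh sh D T i a b = 0.
  have [i_lt|i_ge] := ltnP i n; first by apply: Elt; rewrite // i_lt andbT; lia.
  by have -> : i = n by lia.
move=> E0.
have tE : tail_fv i b k l = tail_f n rh sh D i b.
  by rewrite /tail_fv /tail_f; case: ifP => _;
    rewrite !(mxD, mxN, mxZ); rewrite /D; ring.
apply/eqP; rewrite -subr_eq0; apply/eqP.
rewrite !(mxD, mxN, mxZ) tE.
(* The first two lines express that f~ P carries G_i' to G_i and vanish by [cl] and [cr]; the rest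
   is [commutator_coef]. *)
transitivity ((fv i b * cf (ft i b) a - fv i b * (cf b a * wv i a)) * D (ft i b) a
  + (wv' i b * fv i a * cf b (ft i a) - fv i a * cf b a) * D b (ft i a)
  + commutator_coef n rh sh D T i a b).
  by rewrite /commutator_coef /D /T; ring.
by rewrite cl cr E0 !subrr; ring.
Qed.

End Matrices.

(** * The form on weights *)

Section WeightForm.
Set Implicit Arguments.
Unset Strict Implicit.
Variable n : nat.
Hypothesis n_ge4 : (4 <= n)%N.

Local Notation alphas := (\matrix_(i < n) alpha n i.+1).

Lemma epsilon_mulmx m (G : nat -> 'I_m -> rat) a j : (1 <= a <= n)%N ->
  (epsilon n a *m \matrix_(k < n, l < m) G k.+1 l) 0 j = G a j.
Proof.
move=> a_n; have lt_a : (a.-1 < n)%N by lia.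
rewrite mxE (bigD1 (Ordinal lt_a)) //= !mxE /= prednK; last by lia.
rewrite eqxx mul1r big1 ?addr0 // => k ki; rewrite !mxE.
have -> : (k.+1 == a) = false; last by rewrite mul0r.
apply: contra_neqF ki => /eqP E'; apply: val_inj => /=; lia.
Qed.

Lemma mulmx_epsilonT m (G : 'I_m -> nat -> rat) b i : (1 <= b <= n)%N ->
  (\matrix_(l < m, k < n) G l k.+1 *m (epsilon n b)^T) i 0 = G i b.
Proof.
move=> b_n; have lt_b : (b.-1 < n)%N by lia.
rewrite mxE (bigD1 (Ordinal lt_b)) //= !mxE /= prednK; last by lia.
rewrite eqxx mulr1 big1 ?addr0 // => k kb; rewrite !mxE.
have -> : (k.+1 == b) = false; last by rewrite mulr0.
apply: contra_neqF kb => /eqP E'; apply: val_inj => /=; lia.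
Qed.

Lemma epsilon_form (G : nat -> nat -> rat) a b :
  (1 <= a <= n)%N -> (1 <= b <= n)%N ->
  epsilon n a *m \matrix_(k < n, l < n) G k.+1 l.+1 *m (epsilon n b)^T = (G a b)%:M.
Proof.
move=> a_n b_n; rewrite [LHS]mx11_scalar; congr (_%:M).
rewrite -[RHS](mulmx_epsilonT (fun _ : 'I_1 => G a) 0) //.
congr ((_ *m _) _ _); apply/matrixP => x y.
by rewrite [x]ord1 (epsilon_mulmx (fun k (l : 'I_n) => G k l.+1)) // mxE.
Qed.

(** The coordinates of the fundamental weights of D_n, the last two being the spin weights. They are
    dual to the simple roots and so form the inverse matrix. *)
Definition weight_level (k j : nat) : rat :=
  if (j <= n - 2)%N then (k <= j)%N%:R
  else if (j == n) || (k != n) then 2^-1 else - 2^-1.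

Lemma alphas_unit : alphas \in unitmx.
Proof.
have : alphas *m (\matrix_(k < n, j < n) weight_level k.+1 j.+1) = 1%:M.
  apply/matrixP => i j.
  transitivity ((alpha n i.+1 *m \matrix_(k < n, j < n) weight_level k.+1 j.+1) 0 j).
    by rewrite !mxE; apply: eq_bigr => k _; rewrite !mxE.
  have i_n := ltn_ord i; have j_n := ltn_ord j.
  have mxD (A B : 'rV[rat]_n) : (A + B) 0 j = A 0 j + B 0 j by rewrite mxE.
  have mxN (A : 'rV[rat]_n) : (- A) 0 j = - A 0 j by rewrite mxE.
  rewrite [RHS]mxE -val_eqE /= /alpha; case: eqP => i_eq.
    rewrite mulmxDl mxD.
    rewrite !(epsilon_mulmx (fun k (l : 'I_n) => weight_level k l.+1)); try lia.
    by rewrite /weight_level; split_ifs; decide_bools.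
  rewrite mulmxBl mxD mxN.
  rewrite !(epsilon_mulmx (fun k (l : 'I_n) => weight_level k l.+1)); try lia.
  rewrite /weight_level; case: (ltngtP i j) => ij; split_ifs; decide_bools => //.
  by case/mulmx1_unit.
Qed.

Definition root_form (c : int * int -> int) : 'M[rat]_n :=
  \matrix_(i < n, j < n) (c (pexp n i.+1 j.+1))%:~R.

(* The exponents of r and s in <w'_(epsilon b), w_(epsilon a)>. *)
Definition eps_form_r (b a : nat) : rat := if (a <= b)%N then 2^-1 else - 2^-1.
Definition eps_form_s (b a : nat) : rat := if (a < b)%N then 2^-1 else - 2^-1.

(** Both sides are bilinear, so agreement on pairs of simple roots suffices; [g a] is the value of
    the form on epsilon_a and alpha_j. *)
Lemma root_form_epsilon c (G : nat -> nat -> rat) :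
  (forall i j, (1 <= i <= n)%N -> (1 <= j <= n)%N ->
    let g a := if j == n then G a (n - 1)%N + G a n else G a j - G a j.+1 in
    (c (pexp n i j))%:~R =
      if i == n then g (n - 1)%N + g n else g i - g i.+1) ->
  root_form c = alphas *m (\matrix_(k < n, l < n) G k.+1 l.+1) *m alphas^T.
Proof.
move=> cG; set M := (X in _ *m X *m _).
apply/matrixP => i j; have i_n := ltn_ord i; have j_n := ltn_ord j.
have -> : (alphas *m M *m alphas^T) i j =
    (alpha n i.+1 *m M *m (alpha n j.+1)^T) 0 0.
  rewrite !mxE; apply: eq_bigr => k _; rewrite !mxE; congr (_ * _).
  by apply: eq_bigr => l _; rewrite !mxE.
rewrite mxE cG; try lia.
have E a b : (1 <= a <= n)%N -> (1 <= b <= n)%N ->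
    (epsilon n a *m M *m (epsilon n b)^T) 0 0 = G a b.
  by move=> a_n b_n; rewrite epsilon_form // mxE eqxx.
have mxD (A B : 'M[rat]_1) : (A + B) 0 0 = A 0 0 + B 0 0 by rewrite mxE.
have mxN (A : 'M[rat]_1) : (- A) 0 0 = - A 0 0 by rewrite mxE.
have tD (x y : 'rV[rat]_n) : (x + y)^T = x^T + y^T by rewrite linearD.
have tN (x : 'rV[rat]_n) : (- x)^T = - x^T by rewrite linearN.
rewrite /alpha; case: eqP => j_eq; case: eqP => i_eq;
  rewrite !(tD, tN, mulmxDl, mulmxDr, mulNmx, mulmxN, mxD, mxN) !E; try lia.
all: ring.
Qed.

Lemma root_form_r : root_form fst =
  alphas *m (\matrix_(k < n, l < n) eps_form_r k.+1 l.+1) *m alphas^T.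
Proof.
apply: root_form_epsilon => i j i_n j_n /=.
rewrite /pexp /eps_form_r; split_ifs; by [].
Qed.

Lemma root_form_s : root_form snd =
  alphas *m (\matrix_(k < n, l < n) eps_form_s k.+1 l.+1) *m alphas^T.
Proof.
apply: root_form_epsilon => i j i_n j_n /=.
rewrite /pexp /eps_form_s; split_ifs; by [].
Qed.

(** Root coordinates multiply by the inverse of the matrix of simple roots, which cancels against
    the two outer factors: the form is evaluated directly in the coordinates of R^n. *)
Lemma root_coord_form c M (mu lambda : 'rV[rat]_n) :
  root_form c = alphas *m M *m alphas^T ->
  \sum_(i < n) \sum_(j < n) root_coord mu 0 i * root_coord lambda 0 j
     * (c (pexp n i.+1 j.+1))%:~R = (mu *m M *m lambda^T) 0 0.
Proof.
move=> cM.
have -> : mu *m M *m lambda^T =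
    root_coord mu *m root_form c *m (root_coord lambda)^T.
  rewrite cM /root_coord trmx_mul -!mulmxA.
  have -> : alphas^T *m ((invmx alphas)^T *m lambda^T) = lambda^T.
    by rewrite mulmxA -trmx_mul mulVmx ?alphas_unit // trmx1 mul1mx.
  by congr (_ *m _); rewrite mulmxA mulVmx ?alphas_unit // mul1mx.
rewrite [RHS]mxE exchange_big /=; apply: eq_bigr => j _.
rewrite [X in _ = X * _]mxE mulr_suml; apply: eq_bigr => i _.
by rewrite [root_form c _ _]mxE [_^T _ _]mxE mulrAC.
Qed.

Definition weight_idx a : nat := if (a <= n)%N then a else prime_idx n a.

Lemma weight_form (G : nat -> nat -> rat) a b :
  (1 <= a <= 2 * n)%N -> (1 <= b <= 2 * n)%N ->
  (weight n b *m (\matrix_(k < n, l < n) G k.+1 l.+1) *m (weight n a)^T) 0 0 =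
  (if (a <= n)%N == (b <= n)%N then 1 else -1) * G (weight_idx b) (weight_idx a).
Proof.
move=> a_n b_n; rewrite /weight /weight_idx.
have tN (x : 'rV[rat]_n) : (- x)^T = - x^T by rewrite linearN.
case: ifP => b_le; case: ifP => a_le; rewrite ?tN ?mulNmx ?mulmxN ?mulNmx;
  rewrite epsilon_form ?mxE ?eqxx ?mul1r ?mulN1r ?opprK /prime_idx //; lia.
Qed.

Lemma f_factor_coef (K : fieldType) (rh sh : K) a b : rh != 0 -> sh != 0 ->
  (1 <= a <= 2 * n)%N -> (1 <= b <= 2 * n)%N ->
  f_factor rh sh (weight n a) (weight n b) = braid_coef n rh sh a b.
Proof.
move=> rh0 sh0 a_n b_n; rewrite /f_factor /weight_pairing.
rewrite (root_coord_form _ _ root_form_r) (root_coord_form _ _ root_form_s).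
rewrite !weight_form //.
have c1 : numq (2 * (1 * 2^-1)) = 1 by [].
have c2 : numq (2 * (1 * - 2^-1)) = -1 by [].
have c3 : numq (2 * (-1 * 2^-1)) = -1 by [].
have c4 : numq (2 * (-1 * - 2^-1)) = 1 by [].
rewrite /rs_monomial /eps_form_r /eps_form_s /weight_idx /braid_coef /braid_sign.
rewrite /prime_idx.
have [a_le|a_gt] := leqP a n; have [b_le|b_gt] := leqP b n => /=; split_ifs;
  rewrite ?c1 ?c2 ?c3 ?c4 ?exprN1 ?expr1z;
  by rewrite !(invfM, invrK).
Qed.

End WeightForm.

(** * The explicit braiding *)

Section Braiding.
Set Implicit Arguments.
Unset Strict Implicit.
Lemma strict_upper_mulmx (K : pzRingType) N k (A B : 'M[K]_N) :
  (forall x y : 'I_N, A x y != 0 -> (x + k <= y)%N) ->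
  (forall x y : 'I_N, B x y != 0 -> (x < y)%N) ->
  forall x y : 'I_N, (A *m B) x y != 0 -> (x + k.+1 <= y)%N.
Proof.
move=> Ak B1 x y; apply: contraR => xy; rewrite mxE big1 // => z _.
have [->|/Ak xz] := eqVneq (A x z) 0; first by rewrite mul0r.
have [->|/B1 zy] := eqVneq (B z y) 0; first by rewrite mulr0.
by case/negP: xy; lia.
Qed.

Variables (n : nat) (K : fieldType) (rh sh : K).
Hypotheses (n_ge4 : (4 <= n)%N) (rh0 : rh != 0) (sh0 : sh != 0).
Local Notation N := (2 * n)%N.
Local Notation bar := (prime_idx n).
Local Notation E := (@Emx n K).
Local Notation r := (rh ^+ 2).
Local Notation s := (sh ^+ 2).
Local Notation q := (rh^-1 * sh).
Local Notation t := ((rh * sh)^-1).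
Local Notation kappa := (q - q^-1).
Local Notation rp := (rho_pow n rh sh).
Local Notation cf := (braid_coef n rh sh).
Local Notation vv := (vv n K).

Lemma sum2_vv (P : nat -> nat -> bool) (c : nat -> nat -> K)
    (k l m p : nat -> nat -> nat) a b x0 y0 :
  (1 <= a <= N)%N -> (1 <= b <= N)%N -> (1 <= x0 <= N)%N -> (1 <= y0 <= N)%N ->
  (forall i j, (1 <= i <= N)%N -> (1 <= j <= N)%N ->
    (l i j == a) && (p i j == b) = (i == x0) && (j == y0)) ->
  (\sum_(1 <= i < N.+1) \sum_(1 <= j < N.+1 | P i j)
      c i j *: (E (k i j) (l i j) *t E (m i j) (p i j))) *m vv a b =
  (c x0 y0 * (P x0 y0)%:R) *: vv (k x0 y0) (m x0 y0).
Proof.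
move=> a_N b_N x_N y_N lp; rewrite mulmx_suml.
rewrite (eq_big_nat _ _ (F2 := fun i => (((i == x0) && true)%:R * 1) *:
   ((c i y0 * (P i y0)%:R) *: vv (k i y0) (m i y0)))); last first.
  move=> i i_N; rewrite mulmx_suml big_mkcond /=.
  rewrite (eq_big_nat _ _ (F2 := fun j => (c i j * (P i j)%:R * (i == x0)%:R *
    ((j == y0) && true)%:R) *: vv (k i j) (m i j))).
    rewrite (sum_nat_deltaZ predT predT
      (fun j => c i j * (P i j)%:R * (i == x0)%:R)); last lia.
    rewrite /= !andbT scalerA; congr (_ *: _).
    by rewrite !mulr1 mulrC.
  move=> j j_N; case: (P i j); last by rewrite mulr0 !mul0r scale0r.
  rewrite -scalemxAl Emx2_vv // scalerA lp; [|lia|lia].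
  by rewrite mulr1 andbT -mulrA -natrM mulnb.
under eq_bigr do rewrite mulrC mul1r -[X in X *: _]mul1r.
rewrite (sum_nat_deltaZ predT predT (fun=> 1)); last lia.
by rewrite mul1r scale1r.
Qed.

Lemma flip_vv a b : (1 <= a <= N)%N -> (1 <= b <= N)%N ->
  flip n K *m vv a b = vv b a.
Proof.
move=> a_N b_N; rewrite /flip.
under eq_bigr do under eq_bigr do rewrite -[_ *t _]scale1r.
rewrite (@sum2_vv (fun _ _ => true) (fun _ _ => 1) (fun i j => j)
  (fun i j => i) (fun i j => i) (fun i j => j) a b a b) //.
by rewrite mul1r scale1r.
Qed.

Lemma f_tilde_vv a b : (1 <= a <= N)%N -> (1 <= b <= N)%N ->
  f_tilde n rh sh *m vv a b = cf a b *: vv a b.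
Proof.
move=> a_N b_N; rewrite /f_tilde.
rewrite (@sum2_vv (fun _ _ => true) _ (fun i j => i)
  (fun i j => i) (fun i j => j) (fun i j => j) a b a b) //.
by rewrite mulr1 f_factor_coef.
Qed.

Definition braid_rhs : 'M[K]_(N * N) :=
    q *: (\sum_(1 <= i < N.+1) (E i i *t E i i))
  + (rh * sh^-1) *: (\sum_(1 <= i < N.+1) (E i (bar i) *t E (bar i) i))
  + (rh^-1 * sh^-1) *:
      (\sum_(1 <= i < N.+1) \sum_(1 <= j < N.+1 | S1 n i j) (E i j *t E j i)
     + \sum_(1 <= i < N.+1) \sum_(1 <= j < N.+1 | S2 n i j) (E j i *t E i j))
  + (rh * sh) *:
      (\sum_(1 <= i < N.+1) \sum_(1 <= j < N.+1 | S1 n i j) (E j i *t E i j)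
     + \sum_(1 <= i < N.+1) \sum_(1 <= j < N.+1 | S2 n i j) (E i j *t E j i))
  + (q - rh * sh^-1) *:
      (\sum_(1 <= i < N.+1) \sum_(1 <= j < N.+1 | (i < j)%N) (E j j *t E i i)
     - \sum_(1 <= i < N.+1) \sum_(1 <= j < N.+1 | (j < i)%N)
         (q ^ (rho_idx n i - rho_idx n j))
           *: (E i (bar j) *t E (bar i) j)).

Lemma sum1_vv (k l m p : nat -> nat) (c : bool) a b x0 :
  (1 <= a <= N)%N -> (1 <= b <= N)%N -> (1 <= x0 <= N)%N ->
  (forall i, (1 <= i <= N)%N -> (l i == a) && (p i == b) = (i == x0) && c) ->
  (\sum_(1 <= i < N.+1) (E (k i) (l i) *t E (m i) (p i))) *m vv a b =
  c%:R *: vv (k x0) (m x0).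
Proof.
move=> a_N b_N x_N lp; rewrite mulmx_suml.
rewrite (eq_big_nat _ _ (F2 := fun i => (c%:R * ((i == x0) && true)%:R) *:
   vv (k i) (m i))); last first.
  by move=> i i_N; rewrite Emx2_vv // lp // andbT -natrM mulnb andbC.
by rewrite (sum_nat_deltaZ predT predT (fun=> c%:R)) ?mulr1 //; lia.
Qed.

(** [S1] and [S2] split the pairs i < j with j != i' into two disjoint sets, so for given a and b
    exactly one of the six indicators is nonzero. *)
Lemma braid_rhs_coef a b : (1 <= a <= N)%N -> (1 <= b <= N)%N ->
  q * (a == b)%:R + (rh * sh^-1) * (a == bar b)%:R
  + (rh^-1 * sh^-1) * ((S1 n b a)%:R + (S2 n a b)%:R)
  + (rh * sh) * ((S1 n a b)%:R + (S2 n b a)%:R) = cf b a.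
Proof.
move=> a_N b_N; rewrite /braid_coef /braid_sign /prime_idx.
split_ifs; repeat match goal with
  | |- context [S1 ?m ?x ?y] =>
      first [ have -> : S1 m x y = true by rewrite /S1 /prime_idx; lia
            | have -> : S1 m x y = false by rewrite /S1 /prime_idx; lia
            | case: (boolP (S1 m x y)); rewrite {1}/S1 /prime_idx => ? ]
  | |- context [S2 ?m ?x ?y] =>
      first [ have -> : S2 m x y = true by rewrite /S2 /prime_idx; lia
            | have -> : S2 m x y = false by rewrite /S2 /prime_idx; lia ]
  end; decide_bools;
  rewrite /=; by field; rewrite ?rh0 ?sh0 ?oner_eq0.
Qed.

Lemma braid_rhs_act : braid_act rh sh braid_rhs.
Proof.
move=> a b a_N b_N.
have bar_a : (1 <= bar a <= N)%N by rewrite /prime_idx; lia.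
have bar_b : (1 <= bar b <= N)%N by rewrite /prime_idx; lia.
pose U (P : nat -> nat -> bool) (k l m p : nat -> nat -> nat) :=
  \sum_(1 <= i < N.+1) \sum_(1 <= j < N.+1 | P i j)
     (E (k i j) (l i j) *t E (m i j) (p i j)).
have UE P k l m p x0 y0 : (1 <= x0 <= N)%N -> (1 <= y0 <= N)%N ->
  (forall i j, (1 <= i <= N)%N -> (1 <= j <= N)%N ->
    (l i j == a) && (p i j == b) = (i == x0) && (j == y0)) ->
  U P k l m p *m vv a b = (P x0 y0)%:R *: vv (k x0 y0) (m x0 y0).
  move=> x_N y_N lp; rewrite /U.
  under eq_bigr do under eq_bigr do rewrite -[_ *t _]scale1r.
  by rewrite (@sum2_vv P (fun _ _ => 1) k l m p a b x0 y0) //= mul1r.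
have Eii := @sum1_vv id id id id (a == b) a b a a_N b_N a_N.
have Eib := @sum1_vv id bar bar id (bar b == a) a b b a_N b_N b_N.
(* On v_a (x) v_b only one index pair contributes: (i, j) = (b, a) for E_ij (x) E_ji and for E_jj
   (x) E_ii, and (a, b) for E_ji (x) E_ij. *)
have E1 (P : nat -> nat -> bool) := UE P (fun i _ => i) (fun _ j => j)
   (fun _ j => j) (fun i _ => i) b a b_N a_N.
have E2 (P : nat -> nat -> bool) := UE P (fun _ j => j) (fun i _ => i)
   (fun i _ => i) (fun _ j => j) a b a_N b_N.
have E3 (P : nat -> nat -> bool) := UE P (fun _ j => j) (fun _ j => j)
   (fun i _ => i) (fun i _ => i) b a b_N a_N.
rewrite /U /= in E1 E2 E3.
have E4 : (\sum_(1 <= i < N.+1) \sum_(1 <= j < N.+1 | (j < i)%N)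
    q ^ (rho_idx n i - rho_idx n j) *: (E i (bar j) *t E (bar i) j)) *m vv a b =
    ((a == bar b)%:R * (rp b)^-1) *: tail n rh sh b.
  rewrite mulmx_suml /tail scaler_sumr.
  rewrite [RHS](big_nat_widenl _ 1) //.
  rewrite [RHS]big_mkcond /=; apply: eq_big_nat => i i_N.
  rewrite mulmx_suml big_mkcond /=.
  rewrite (eq_big_nat _ _ (F2 := fun j =>
    ((j < i)%:R * q ^ (rho_idx n i - rho_idx n j) * ((j == b) && (bar b == a))%:R)
      *: vv i (bar i))); last first.
    move=> j j_N; case: ltnP => _; last by rewrite !mul0r scale0r.
    rewrite -scalemxAl Emx2_vv // scalerA mul1r; congr ((_ * _%:R) *: _).
    by case: (eqVneq j b) => [->|]; rewrite ?andbT ?andbF.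
  rewrite (sum_nat_deltaZ predT (fun=> bar b == a)
    (fun j => (j < i)%:R * q ^ (rho_idx n i - rho_idx n j))
    (fun=> vv i (bar i))); last lia.
  rewrite scalerA /=; case: ltnP => b_i; last by rewrite !mul0r scale0r.
  rewrite expfzDr ?q_neq0 // -invr_expz [bar b == a]eq_sym; congr (_ *: _).
  by rewrite /rho_pow mul1r; ring.
rewrite /braid_rhs !mulmxDl -!scalemxAl !mulmxDl mulNmx Eii; last first.
  by move=> i _; case: (eqVneq i a) => [->|].
rewrite Eib; last first.
  by move=> i _; case: (eqVneq i b) => [->|]; rewrite ?andbT ?andbF.
rewrite !E1; try by move=> i j _ _; rewrite andbC.
rewrite !E2; try by [].
rewrite E3; last by move=> i j _ _; rewrite /= andbC; case: eqP.
rewrite E4 -braid_rhs_coef //.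
have Ea : (a == b)%:R *: vv a a = (a == b)%:R *: vv b a.
  by case: eqP => [->|]; rewrite ?scale0r.
have Eb : (bar b == a)%:R *: vv b (bar b) = (a == bar b)%:R *: vv b a.
  by rewrite eq_sym; case: eqP => [->|]; rewrite ?scale0r.
have -> : q - rh * sh^-1 = kappa by rewrite invfM invrK.
move: kappa => kp; rewrite Ea Eb !scalerDr scalerN !scalerA !mulrDr !scalerDl.
by rewrite -!addrA mulrA.
Qed.

Lemma f_tilde_flip_vv a b : (1 <= a <= N)%N -> (1 <= b <= N)%N ->
  f_tilde n rh sh *m flip n K *m vv a b = cf b a *: vv b a.
Proof. by move=> a_N b_N; rewrite -mulmxA flip_vv // f_tilde_vv. Qed.

Lemma f_tilde_flip_lowering i : (1 <= i <= n)%N ->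
  f_tilde n rh sh *m flip n K *m lowering_w' n rh sh i =
  lowering_w n rh sh i *m (f_tilde n rh sh *m flip n K).
Proof.
move=> i_n; apply: vv_ext => a b a_N b_N.
rewrite -[LHS]mulmxA lowering_w'_vv // mulmxDr -!scalemxAr.
rewrite -[RHS]mulmxA f_tilde_flip_vv // -scalemxAr lowering_w_vv //.
rewrite scalerDr !scalerA addrC; congr (_ + _).
  have [->|f0] := eqVneq (f_val n rh sh i a) 0.
    by rewrite ?(mulr0, mul0r, scale0r).
  have [fa _] := f_to_range n_ge4 rh0 sh0 i_n f0.
  rewrite f_tilde_flip_vv // scalerA -(braid_coef_f_r n_ge4 rh0 sh0 i_n b_N f0).
  by congr (_ *: _); ring.
have [->|f0] := eqVneq (f_val n rh sh i b) 0.
  by rewrite ?(mulr0, mul0r, scale0r).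
have [fb _] := f_to_range n_ge4 rh0 sh0 i_n f0.
rewrite f_tilde_flip_vv // scalerA (braid_coef_f_l n_ge4 rh0 sh0 i_n a_N f0).
by congr (_ *: _); ring.
Qed.

(** [X] stands for Theta: the two hypotheses are all that is used about it. *)
Lemma intertwiner_eq (X : 'M[K]_(N * N)) :
  (forall i, (1 <= i <= n)%N -> X *m lowering_w n rh sh i = lowering_w' n rh sh i *m X) ->
  (forall a, X *m vv a 1 = vv a 1) ->
  X *m f_tilde n rh sh *m flip n K = braid_rhs.
Proof.
move=> XC X1; rewrite -mulmxA.
apply: (lowering_commutant_eq n_ge4 rh0 sh0) => [i i_n|i i_n|b b_N].
- by rewrite -mulmxA f_tilde_flip_lowering // !mulmxA XC.
- exact: braid_act_commutes braid_rhs_act i_n.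
have N1 : (1 <= 1 <= N)%N by lia.
rewrite -mulmxA f_tilde_flip_vv // -scalemxAr X1 braid_rhs_act //.
(* On v_1 (x) v_b the term L vanishes since no index is below 1, and Q could act only for b = 2n,
   where its sum over k > b is empty. *)
have -> : (b < 1)%N = false by lia.
rewrite mulr0 scale0r addr0.
have [E1|_] := eqVneq 1%N (bar b); last by rewrite mulr0 mul0r scale0r subr0.
have -> : b = N by move: E1; rewrite /prime_idx; lia.
by rewrite /tail big_geq // scaler0 subr0.
Qed.

Local Notation e i := (e_mx n rh sh i).

Lemma e_mx_ev1 i : (1 <= i <= n)%N -> e i *m ev n K 1 = 0.
Proof.
move=> i_n; rewrite /e_mx; case: ltnP => i_lt;
  rewrite mulmxBl -scalemxAl !Emx_ev //; try lia.
  have -> : (i.+1 == 1)%N = false by lia.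
  have -> : (bar i == 1)%N = false by rewrite /prime_idx; lia.
  by rewrite !scale0r scaler0 subr0.
have -> : (n + 2 == 1)%N = false by lia.
have -> : (n + 1 == 1)%N = false by lia.
by rewrite !scale0r scaler0 subr0.
Qed.

Lemma e_mx_upper i (x y : 'I_N) : (1 <= i <= n)%N -> e i x y != 0 -> (x < y)%N.
Proof.
move=> i_n; apply: contraR; rewrite -leqNgt => y_x.
have E0 k l : (k < l)%N -> E k l x y = 0.
  move=> kl; rewrite mxE; suff -> : (x.+1 == k) && (y.+1 == l) = false by [].
  lia.
rewrite /e_mx; case: ifP => i_lt; rewrite mxE [X in _ + X]mxE [X in _ - X]mxE;
  rewrite !E0 ?mulr0 ?subr0 //; rewrite /prime_idx; lia.
Qed.

End Braiding.

(** * The quantum group *)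

Section QuantumGroup.
Set Implicit Arguments.
Unset Strict Implicit.

Lemma presented_piM (K : fieldType) (X : choiceType)
    (rel : free_alg K X -> free_alg K X -> Prop) (x y : free_alg K X) :
  presented_pi rel (x * y) = presented_pi rel x * presented_pi rel y.
Proof. exact: (presented_pi_is_multiplicative rel).2. Qed.

Lemma presented_piB (K : fieldType) (X : choiceType)
    (rel : free_alg K X -> free_alg K X -> Prop) (x y : free_alg K X) :
  presented_pi rel (x - y) = presented_pi rel x - presented_pi rel y.
Proof. exact: presented_pi_is_additive. Qed.

Lemma presented_pi_commutator (K : fieldType) (X : choiceType)
    (rel : free_alg K X -> free_alg K X -> Prop) (x y : free_alg K X) :
  presented_pi rel (x * y - y * x) =
  presented_pi rel x * presented_pi rel y - presented_pi rel y * presented_pi rel x.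
Proof.
exact: etrans (presented_piB _ _ _) (congr2 (fun a b => a - b)
  (presented_piM rel x y) (presented_piM rel y x)).
Qed.

Variables (n : nat) (K : fieldType) (r s : K).
Local Notation U := (U n r s).
Local Notation e := (@Ue n K r s).
Local Notation f := (@Uf n K r s).
Local Notation w := (@Uw n K r s).
Local Notation w' := (@Uw' n K r s).
Local Notation p i j := (@pmat n K r s (i : 'I_n).+1 (j : 'I_n).+1).
Implicit Types (i j : 'I_n) (x y : U).

Lemma tensM x y x' y' : tens x y * tens x' y' = tens (x * x') (y * y').
Proof.
have H := presented_rel (tensor_rel_mul (relX := @Urel n K r s)
  (relY := @Urel n K r s) x x' y y').
by rewrite presented_piM in H.
Qed.

Lemma tens1 : tens 1 1 = 1 :> U2 n r s.
Proof. exact: presented_rel (tensor_rel_one (@Urel n K r s) (@Urel n K r s)). Qed.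

Lemma Uw_e i j : w j * e i = p i j *: (e i * w j).
Proof.
have H := presented_rel (Urel_we r s i j).
by rewrite presented_piM presented_piZ presented_piM in H.
Qed.

Lemma Uw'_e i j : w' j * e i = (p j i)^-1 *: (e i * w' j).
Proof.
have H := presented_rel (Urel_w'e r s i j).
by rewrite presented_piM presented_piZ presented_piM in H.
Qed.

Lemma Ue_f i j :
  e i * f j - f j * e i = (i == j)%:R *: (- (s - r)^-1 *: (w i - w' i)).
Proof.
rewrite -invrN opprB.
have H := presented_rel (Urel_ef r s i j).
rewrite [LHS]presented_pi_commutator in H.
case: (i == j) H => H.
  by rewrite presented_piZ presented_piB in H; rewrite scale1r.
by rewrite scale0r.
Qed.

Hypotheses (r0 : r != 0) (s0 : s != 0).

Lemma pmat_neq0 i j : p i j != 0.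
Proof. by rewrite mulf_neq0 // expfz_neq0. Qed.

Lemma e_mon_rev t : e_mon (1 : U) *%R e (rev t) = \prod_(i <- t) e i.
Proof.
elim/last_ind: t => [|t i IHt]; first by rewrite big_nil.
by rewrite rev_rcons /= IHt -cats1 big_cat big_seq1.
Qed.

Lemma f_mon_rev t : f_mon (1 : U) *%R f (rev t) = \prod_(i <- t) f i.
Proof.
elim/last_ind: t => [|t i IHt]; first by rewrite big_nil.
by rewrite rev_rcons /= IHt -cats1 big_cat big_seq1.
Qed.

Lemma Upos_weightE zeta :
  Upos_weight zeta = lin_span (e_mons (1 : U) *%R e zeta).
Proof.
congr lin_span; apply/funext => x; apply/propext; split=> -[t [tz ->]].
  by exists (rev t); rewrite e_mon_rev; split=> // k; rewrite count_rev.
exists (rev t); split=> [k|]; first by rewrite count_rev.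
by rewrite -e_mon_rev revK.
Qed.

Lemma Uneg_weightE zeta :
  Uneg_weight zeta = lin_span (f_mons (1 : U) *%R f zeta).
Proof.
congr lin_span; apply/funext => x; apply/propext; split=> -[t [tz ->]].
  by exists (rev t); rewrite f_mon_rev; split=> // k; rewrite count_rev.
exists (rev t); split=> [k|]; first by rewrite count_rev.
by rewrite -f_mon_rev revK.
Qed.

End QuantumGroup.

(** * Consequences of algebraic independence *)

Section AlgIndependent.
Set Implicit Arguments.
Unset Strict Implicit.
Variables (K : fieldType) (r s : K).
Hypothesis hrs : alg_independent2 r s.

Let eval (p : {poly rat}) : K := (map_poly ratr p).[r].

Let eval0 : eval 0 = 0.
Proof. by rewrite /eval map_poly0 horner0. Qed.

Let evalX : eval 'X = r.
Proof.
rewrite /eval; suff -> : map_poly ratr 'X = 'X :> {poly K} by rewrite hornerX.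
apply/polyP => i; rewrite coef_map_id0 ?coefX ?ratr_nat //.
exact: (ratr_nat K 0).
Qed.

Let eval1 : eval 1 = 1.
Proof.
rewrite /eval; suff -> : map_poly ratr 1 = 1 :> {poly K} by rewrite hornerE.
apply/polyP => i; rewrite coef_map_id0 ?coef1 ?ratr_nat //.
exact: (ratr_nat K 0).
Qed.

(** The inner variable is evaluated at r and the outer one at s; the test polynomial is the inner
    variable, constant in the outer one. *)
Lemma alg_independent2_neq0l : r != 0.
Proof.
have X0 : ('X : {poly rat})%:P != 0 by rewrite polyC_eq0 polyX_eq0.
have := hrs X0; rewrite -/eval.
suff -> : map_poly eval ('X)%:P = r%:P by rewrite hornerC.
apply/polyP => i; rewrite coef_map_id0 // !coefC.
by case: (i == 0)%N; rewrite ?evalX.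
Qed.

Lemma alg_independent2_neq0r : s != 0.
Proof.
have X0 : ('X : {poly {poly rat}}) != 0 by rewrite polyX_eq0.
have := hrs X0; rewrite -/eval.
suff -> : map_poly eval 'X = 'X by rewrite hornerX.
apply/polyP => i; rewrite coef_map_id0 // !coefX.
by case: (i == 1)%N.
Qed.

End AlgIndependent.

Theorem theorem3p8
  (n : nat) (hn : (4 <= n)%N)
  (K : fieldType) (hK : [pchar K] =i pred0)
  (r s : K) (hrs : alg_independent2 r s)
  (rh sh : K) (hrh : rh ^+ 2 = r) (hsh : sh ^+ 2 = s)
  (Delta : {rmorphism U n r s -> U2 n r s}) (hDeltaZ : scalable Delta)
  (hDelta : is_coproduct Delta)
  (eps : {rmorphism U n r s -> K}) (hepsZ : scalable (eps : U n r s -> K^o))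
  (heps : is_counit eps)
  (pair : U n r s -> U n r s -> K) (hpair : skew_dual_pairing Delta eps pair)
  (rho : {rmorphism U n r s -> 'M[K]_(2 * n)}) (hrhoZ : scalable rho)
  (hrho : is_vector_rep rh sh rho)
  (d : {ffun 'I_n -> nat} -> nat)
  (u v : forall zeta, 'I_(d zeta) -> U n r s)
  (huv : dual_bases pair u v) :
  let E := @Emx n K in
  let bar := prime_idx n in
  let N := (2 * n)%N in
  R_VV rh sh rho u v =
    (rh^-1 * sh) *: (\sum_(1 <= i < N.+1) (E i i *t E i i))
  + (rh * sh^-1) *: (\sum_(1 <= i < N.+1) (E i (bar i) *t E (bar i) i))
  + (rh^-1 * sh^-1) *:
      (\sum_(1 <= i < N.+1) \sum_(1 <= j < N.+1 | S1 n i j) (E i j *t E j i)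
     + \sum_(1 <= i < N.+1) \sum_(1 <= j < N.+1 | S2 n i j) (E j i *t E i j))
  + (rh * sh) *:
      (\sum_(1 <= i < N.+1) \sum_(1 <= j < N.+1 | S1 n i j) (E j i *t E i j)
     + \sum_(1 <= i < N.+1) \sum_(1 <= j < N.+1 | S2 n i j) (E i j *t E j i))
  + (rh^-1 * sh - rh * sh^-1) *:
      (\sum_(1 <= i < N.+1) \sum_(1 <= j < N.+1 | (i < j)%N) (E j j *t E i i)
     - \sum_(1 <= i < N.+1) \sum_(1 <= j < N.+1 | (j < i)%N)
         ((rh^-1 * sh) ^ (rho_idx n i - rho_idx n j))
           *: (E i (bar j) *t E (bar i) j)).
Proof.
move=> E bar N.
have r0 := alg_independent2_neq0l hrs; have s0 := alg_independent2_neq0r hrs.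
have rh0 : rh != 0 by apply: contraNneq r0 => rh0; rewrite -hrh rh0 expr0n.
have sh0 : sh != 0 by apply: contraNneq s0 => sh0; rewrite -hsh sh0 expr0n.
rewrite -/(braid_rhs n rh sh).
have rhoL c x y : rho (c *: x + y) = c *: rho x + rho y.
  by rewrite rmorphD; congr (_ + _); exact: hrhoZ.
have rhoM x y : rho (x * y) = rho x *m rho y by rewrite rmorphM.
have rho_e i : rho (Ue r s i) = e_mx n rh sh i.+1 by have [] := hrho i.
have rho_nilp t : (N <= size t)%N -> rho (e_mon (1 : U n r s) *%R (@Ue n K r s) t) = 0.
  move=> Nt; apply/matrixP => a b; rewrite [RHS]mxE; apply/eqP.
  (* Each e_i is strictly upper triangular, so a word of length k lives at distance at least k above
     the diagonal; at length 2n nothing is left. This makes the sum defining Theta finitely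
     supported. *)
  suff H (x y : 'I_N) : rho (e_mon (1 : U n r s) *%R (@Ue n K r s) t) x y != 0 ->
      (x + size t <= y)%N.
    apply: contraT => /H; have := ltn_ord b; rewrite /N in Nt *; lia.
  elim: t {Nt} x y => [|i t IHt] x y.
    rewrite rmorph1 mxE addn0; case: (eqVneq x y) => [->|_] //.
    by rewrite eqxx.
  rewrite /= rhoM rho_e => H; apply: (strict_upper_mulmx IHt) H => x' y'.
  by apply: (e_mx_upper hn rh0 sh0); rewrite ?ltn_ord.
have rho1 : rho 1 = 1%:M by exact: rmorph1.
have Bpos1 : Bpos (1 : U n r s) by exact: subalg_one.
have Bneg1 : Bneg (1 : U n r s) by exact: subalg_one.
have Bpos_e (i : 'I_n) : Bpos (Ue r s i) by apply: subalg_gen; exists i; left.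
have Bpos_w (i : 'I_n) : Bpos (Uw r s i) by apply: subalg_gen; exists i; right; left.
have Bneg_f (i : 'I_n) : Bneg (Uf r s i) by apply: subalg_gen; exists i; left.
have Bneg_w' (i : 'I_n) : Bneg (Uw' r s i) by apply: subalg_gen; exists i; right; left.
have BposM (x y : U n r s) : Bpos x -> Bpos y -> Bpos (x * y) by exact: subalg_mul.
have BnegM (x y : U n r s) : Bneg x -> Bneg y -> Bneg (x * y) by exact: subalg_mul.
have BposL c (x y : U n r s) : Bpos x -> Bpos y -> Bpos (c *: x + y).
  exact: subalg_lin.
have BnegL c (x y : U n r s) : Bneg x -> Bneg y -> Bneg (c *: x + y).
  exact: subalg_lin.
have u_basis (zeta : {ffun 'I_n -> nat}) :
    basis_of_set (lin_span (e_mons (1 : U n r s) *%R (@Ue n K r s) zeta))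
    (u zeta) by rewrite -Upos_weightE; have [] := huv zeta.
have v_basis (zeta : {ffun 'I_n -> nat}) :
    basis_of_set (lin_span (f_mons (1 : U n r s) *%R (@Uf n K r s) zeta))
    (v zeta) by rewrite -Uneg_weightE; have [] := huv zeta.
have uv_dual (zeta : {ffun 'I_n -> nat}) (k l : 'I_(d zeta)) :
    pair (v zeta k) (u zeta l) = (k == l)%:R.
  by have [_ _] := huv zeta; apply.
have pair_f1 (i : 'I_n) : pair (Uf r s i) 1 = 0.
  by rewrite (pair_1r hpair) //; have [_ -> _ _] := heps i.
have pair_w'1 (i : 'I_n) : pair (Uw' r s i) 1 = 1.
  by rewrite (pair_1r hpair) //; have [_ _ _ ->] := heps i.
have highest := theta_total_highest (rmorph1 eps) Bpos1 Bneg1 Bpos_e Bneg_f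
  BposM BnegM BposL BnegL (pair_linl hpair) (pair_linr hpair) (pair_1l hpair)
  u_basis v_basis uv_dual rhoL rhoM rho1 rho_nilp.
have intertwines := @theta_total_intertwines K n (U n r s) (U2 n r s) 1 *%R
  (@mulrA _) (@mul1r _) (@mulr1 _) (@mulrDl _) (@mulrDr _)
  (fun c x y => esym (presented_scaleAl c x y))
  (fun c x y => esym (presented_scaleAr c x y))
  (@tens n K r s) Delta eps (@Ue n K r s) (@Uf n K r s) (@Uw n K r s)
  (@Uw' n K r s) _ _ pair (fun i j => pmat n r s i.+1 j.+1) (s - r)^-1
  (@tensM n K r s) (tens1 n r s) (rmorphM Delta) (rmorph1 Delta)
  (fun i => let: And4 E _ _ _ := hDelta i in E)
  (fun i => let: And4 _ E _ _ := hDelta i in E)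
  (fun i => let: And4 _ _ E _ := hDelta i in E)
  (fun i => let: And4 _ _ _ E := hDelta i in E)
  (fun i => let: And4 E _ _ _ := heps i in E)
  (fun i => let: And4 _ _ E _ := heps i in E)
  (pmat_neq0 r0 s0) (Uw_e r s) (Uw'_e r s) (Ue_f r s)
  Bpos1 Bneg1 Bpos_e Bpos_w Bneg_f Bneg_w' BposM BnegM BposL BnegL
  (pair_linl hpair) (pair_linr hpair) (pair_mulr hpair) (pair_mull hpair)
  (pair_1l hpair) (pair_fe hpair) (pair_ww hpair) (pair_fw hpair) (pair_we hpair)
  pair_f1 pair_w'1 d u v u_basis v_basis uv_dual N rho rhoL rhoM N rho_nilp.
rewrite /R_VV; apply: (intertwiner_eq hn rh0 sh0) => [i i_n|a].
  (* The label i of an operator corresponds to the ordinal i - 1. *)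
  have lt_i : (i.-1 < n)%N by lia.
  have := intertwines (Ordinal lt_i).
  have [_ -> -> ->] := hrho (Ordinal lt_i).
  by rewrite /= prednK ?/lowering_w' ?/lowering_w ?hrh ?hsh //; lia.
apply: highest => i; rewrite rho_e; apply: (e_mx_ev1 hn rh0 sh0).
by rewrite ltn_ord.
Qed.
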